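(* Let $K$ be a field of characteristic $0$, $V=K^{2n}$ ($n\ge1$) with a non-degenerate skew symmetric bilinear form, and $G=\mathrm{Sp}(V)$. The algebra homomorphism $F_r^r:B_r^r(-2n)\to\mathrm{Hom}_{\mathrm{Sp}(V)}(V^{\otimes r},V^{\otimes r})$ from the Brauer algebra of degree $r$ with parameter $-2n$ is injective if $r\le n$. If $r\ge n+1$, then $\mathrm{Ker}\,F_r^r$ is the two-sided ideal of $B_r^r(-2n)$ generated by the element $$\Phi=\sum_{k=0}^{\left[\frac{n+1}{2}\right]}a_k\,\Xi_k\in B_{n+1}^{n+1}(-2n),\qquad a_k=\frac{1}{(2^kk!)^2(n+1-2k)!},\qquad \Xi_k=\Sigma(n+1)\,E(k)\,\Sigma(n+1),$$ where $\Sigma(n+1)=\sum_{\sigma\in\mathrm{Sym}_{n+1}}\sigma$ and $E(k)=\prod_{j=1}^k e_{n+2-2j}$ ($E(0)=1$).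
   Context: Brauer diagrams. For $k,\ell\in\mathbb{N}$, a $(k,\ell)$ Brauer diagram is a partition into pairs (arcs) of $k$ lower nodes and $\ell$ upper nodes (each row numbered left to right). $B_k^\ell(\delta)$ is the $K$-vector space with basis the $(k,\ell)$ diagrams. Composition is bilinear with $D_1\circ D_2=\delta^fD$, obtained by placing $D_1$ above $D_2$, identifying middle nodes and deleting the $f$ closed loops; $D\otimes D'$ is juxtaposition with $D'$ on the right. $B_r^r(\delta)$ is the Brauer algebra of degree $r$. $I$ is the $(1,1)$ diagram, $X$ the $(2,2)$ crossing (lower $1$–upper $2$, lower $2$–upper $1$), $A$ the $(2,0)$ diagram, $U$ the $(0,2)$ diagram. In $B_r^r(\delta)$, $s_i=I^{\otimes(i-1)}\otimes X\otimes I^{\otimes(r-i-1)}$ and $e_i=I^{\otimes(i-1)}\otimes(U\circ A)\otimes I^{\otimes(r-i-1)}$; the $s_i$ generate a copy of $K\mathrm{Sym}_r$. For $s<r$, $B_s^s(\delta)$ is regarded as a subalgebra of $B_r^r(\delta)$ via $b\mapsto b\otimes I^{\otimes(r-s)}$; in this way $\Phi\in B_r^r(-2n)$ for $r\ge n+1$. $[x]$ denotes integer part. The map $F_r^r$. For a basis $b_i$ of $V$ with dual basis $\bar b_i$, $(\bar b_i,b_j)=\delta_{ij}$, put $c_0=\sum_ib_i\otimes\bar b_i$; $P(v\otimes w)=w\otimes v$, $\check C(1)=c_0$, $\hat C(v\otimes w)=(v,w)$. There is a unique $K$-linear functor $F$ from the category with objects $\mathbb{N}$ and morphisms $B_k^\ell(-2n)$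 to $\mathrm{Sp}(V)$-modules with $F(r)=V^{\otimes r}$, $F(D\otimes D')=F(D)\otimes F(D')$, $F(I)=\mathrm{id}_V$, $F(X)=-P$, $F(U)=\check C$, $F(A)=\hat C$; $F_r^r$ is its restriction to $B_r^r(-2n)$. Thus $F_r^r(s_i)$ is $-P$ acting on tensor factors $i,i+1$, and $F_r^r(e_i)$ is $\check C\hat C$ acting on factors $i,i+1$. *)

(* Defs.v *)
From HB Require Import structures.
From mathcomp Require Import all_boot all_order all_fingroup all_algebra zify.
Set Implicit Arguments.
Unset Strict Implicit.
Unset Printing Implicit Defensive.
Import GRing.Theory.
Local Open Scope ring_scope.

(* [inl i] is the [i]-th lower node and [inr j] the [j]-th upper node, both
   numbered from 0. *)
Notation node k l := ('I_k + 'I_l)%type.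

Definition is_pairing (T : finType) (P : {set {set T}}) : bool :=
  partition P [set: T] && [forall B in P, #|B| == 2].

Record diagram (k l : nat) := Diagram {
  arcs : {set {set node k l}};
  arcsP : is_pairing arcs
}.

HB.instance Definition _ k l := [isSub for @arcs k l].
HB.instance Definition _ k l := [Finite of diagram k l by <:].

Section Pairing.
Variable T : finType.

Lemma involution_pairing (f : T -> T) :
  involutive f -> (forall x, f x != x) ->
  is_pairing [set [set x; f x] | x in [set: T]].
Proof.
move=> fK fx; apply/andP; split; last first.
  by apply/forall_inP=> _ /imsetP[x _ ->]; rewrite cards2 [x == _]eq_sym fx.
apply/and3P; split.
- apply/eqP/setP=> x; rewrite inE; apply/bigcupP.
  by exists [set x; f x]; [apply: imset_f | rewrite !inE eqxx].
- apply/trivIsetP=> _ _ /imsetP[x _ ->] /imsetP[y _ ->]; apply: contraR.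
  case/pred0Pn=> z /andP[/set2P zx /set2P zy].
  have pairE u : z = u \/ z = f u -> [set u; f u] = [set z; f z].
    by case=> ->; rewrite // fK setUC.
  by rewrite (pairE x zx) (pairE y zy).
- by apply/imsetP=> -[x _ /setP/(_ x)]; rewrite !inE eqxx.
Qed.

Variables (P : {set {set T}}) (PP : is_pairing P).

Definition partner (x : T) : T := odflt x [pick y | [set x; y] \in P].

Lemma pairing_neq x y : [set x; y] \in P -> y != x.
Proof.
case/andP: PP => _ /forall_inP P2 /P2; rewrite cards2 [x == _]eq_sym.
by case: (y == x).
Qed.

Lemma partner_in x : [set x; partner x] \in P.
Proof.
rewrite /partner; case: pickP => //= noy.
case/andP: PP => /and3P[/eqP covP _ _] /forall_inP P2.
have: x \in cover P by rewrite covP inE.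
case/bigcupP=> B BP xB; move/eqP: (P2 _ BP).
case/eqP/cards2P=> a [b [_ Bab]].
move: xB BP; rewrite Bab => /set2P[] <- abP.
  by have:= noy b; rewrite abP.
by have:= noy a; rewrite setUC abP.
Qed.

Lemma pairing_partner x y : ([set x; y] \in P) = (y == partner x).
Proof.
apply/idP/eqP=> [xyP | ->]; last exact: partner_in.
case/andP: (PP) => /and3P[_ /trivIsetP tiP _] _.
have [eqB | neB] := eqVneq [set x; y] [set x; partner x].
  have: y \in [set x; partner x] by rewrite -eqB !inE eqxx orbT.
  by case/set2P=> // yx; have:= pairing_neq xyP; rewrite yx eqxx.
have/pred0P/(_ x) := tiP _ _ xyP (partner_in x) neB.
by rewrite /= !inE eqxx.
Qed.

Lemma partnerK : involutive partner.
Proof.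
by move=> x; apply/esym/eqP; rewrite -pairing_partner setUC partner_in.
Qed.

Lemma partner_neq x : partner x != x.
Proof. exact: pairing_neq (partner_in x). Qed.

End Pairing.

(* In an orbit of the group generated by two involutions without a common
   fixed point, a point fixed by one of them is one of exactly two such. *)
Lemma dihedral_card (T : finType) (s t : T -> T) (e : rel T) (x : T) :
    involutive s -> involutive t ->
    (forall y, ~~ ((s y == y) && (t y == y))) ->
    (forall y z, e y z = (z != y) && ((z == s y) || (z == t y))) ->
    s x = x ->
  #|[set y | connect e x y & (s y == y) || (t y == y)]| = 2.
Proof.
move=> sK tK st0 eE sx.
pose g y := s (t y).
have g_inj : injective g by exact: inj_comp (inv_inj sK) (inv_inj tK).
pose N := fingraph.order g x; pose p i := iter i g x.
have N_gt0 : (0 < N)%N by exact: fingraph.order_gt0.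
have pN : p N = x by exact: iter_order.
have sp i : (i <= N)%N -> s (p i) = p (N - i)%N.
  elim: i => [|i IHi] lt_iN; first by rewrite subn0 pN.
  apply: g_inj; rewrite -[g (p _)]/(p (N - i.+1).+1) -subSn // subSS.
  by rewrite -IHi ?(ltnW lt_iN) // /= /g sK tK.
have tp i : (i < N)%N -> t (p i) = p (N - i.+1)%N.
  by move=> lt_iN; rewrite -sp //= /g sK.
have p_inj i j : (i < N)%N -> (j < N)%N -> p i = p j -> i = j.
  move=> iN jN eq_p; rewrite -(findex_iter iN) -(findex_iter jN).
  by congr (findex _ _ _).
have orbE y : connect e x y = fconnect g x y.
  have es u : connect e u (s u).
    have [->|su] := eqVneq (s u) u; first exact: connect0.
    by apply: connect1; rewrite eE su eqxx.
  have et u : connect e u (t u).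
    have [->|tu] := eqVneq (t u) u; first exact: connect0.
    by apply: connect1; rewrite eE tu eqxx orbT.
  apply/idP/idP; last first.
    apply: connect_sub => u v /eqP <-.
    by apply: connect_trans (et _) (es _).
  case/connectP=> q; elim/last_ind: q y => [|q z IHq] y /=.
    by move=> _ ->; apply: connect0.
  rewrite rcons_path last_rcons => /andP[eq_q e_z] ->{y}.
  have /iter_findex := IHq _ eq_q erefl.
  move: (findex_max (IHq _ eq_q erefl)); set i := findex _ _ _.
  rewrite -/N -/(p i) => lt_iN pi; move: e_z; rewrite eE -pi.
  case/andP=> _ /orP[] /eqP->; rewrite ?sp ?tp ?(ltnW lt_iN) //;
  exact: fconnect_iter.
have N_neq1 : N != 1.
  apply/eqP=> N1; have := st0 x; rewrite sx eqxx /=.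
  by rewrite -[X in t X]/(p 0) tp ?N1 //= eqxx.
have half_lt : (N./2 < N)%N.
  by rewrite -divn2 ltn_Pdiv.
have half_neq0 : N./2 != 0.
  by case: (N) N_gt0 N_neq1 => [|[|]].
suff -> : [set y | connect e x y & (s y == y) || (t y == y)]
          = [set x; p N./2].
  rewrite cards2; case: eqP => // eq_x.
  by case/eqP: half_neq0; apply/esym/p_inj.
apply/setP=> y; rewrite !inE orbE; apply/andP/orP; last first.
  case=> /eqP->; rewrite ?sx ?eqxx ?connect0 //.
  split; first exact: fconnect_iter.
  rewrite sp 1?ltnW // tp //.
  have := odd_double_half N; case: (odd N) => /= NE.
    by apply/orP; right; apply/eqP; congr p; lia.
  by apply/orP; left; apply/eqP; congr p; lia.
case=> /[dup] /findex_max; set i := findex _ _ _; rewrite -/N => lt_iN.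
move/iter_findex; rewrite -/i -/(p i) => <-.
have [-> | i_neq0] := eqVneq i 0%N; first by left.
rewrite sp 1?ltnW // tp // => fix_i; right; apply/eqP; congr p.
case/orP: fix_i => /eqP/p_inj fix_i; rewrite -[LHS]fix_i //; lia.
Qed.

Lemma mem_imset_pairing (A T : finType) (f : A -> T) (P : {set {set A}}) y z :
    injective f -> is_pairing P ->
  reflect (exists2 u, y = f u & z = f (partner P u))
          ([set y; z] \in [set f @: (B : {set A}) | B in P]).
Proof.
move=> f_inj PP; have f2 u v : f @: [set u; v] = [set f u; f v].
  by rewrite imsetU1 imset_set1.
apply: (iffP imsetP) => [[B BP yzB] | [u -> ->]]; last first.
  by exists [set u; partner P u]; rewrite ?partner_in ?f2.
have: y \in f @: B by rewrite -yzB !inE eqxx.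
case/imsetP=> u uB yu; have: z \in f @: B by rewrite -yzB !inE eqxx orbT.
case/imsetP=> v vB zv; exists u; rewrite // zv; congr f; apply/eqP.
rewrite -pairing_partner //; suff -> : [set u; v] = B by [].
by apply: (imset_inj f_inj); rewrite f2 -yu -zv.
Qed.

Section Composition.
Variables (k l m : nat).

(* The nodes of [D1] placed above [D2]: lower, middle and upper row. *)
Local Notation stack := ('I_k + 'I_l + 'I_m)%type.

Definition stack_above (x : node l m) : stack :=
  match x with inl i => inl (inr i) | inr j => inr j end.

Definition stack_below (x : node k l) : stack := inl x.

Definition stack_outer (x : node k m) : stack :=
  match x with inl i => inl (inl i) | inr j => inr j end.

Definition stack_arcs (D1 : diagram l m) (D2 : diagram k l) : {set {set stack}} :=
  [set stack_above @: (B : {set _}) | B in arcs D1]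
    :|: [set stack_below @: (B : {set _}) | B in arcs D2].

Definition stack_adj (D1 : diagram l m) (D2 : diagram k l) : rel stack :=
  fun x y => [set x; y] \in stack_arcs D1 D2.

Definition closed_loops (D1 : diagram l m) (D2 : diagram k l) : nat :=
  #|[set C in equivalence_partition (connect (stack_adj D1 D2)) [set: stack]
       | [disjoint C & codom stack_outer]]|.

Definition comp_arcs (D1 : diagram l m) (D2 : diagram k l) : {set {set node k m}} :=
  equivalence_partition
    (fun x y => connect (stack_adj D1 D2) (stack_outer x) (stack_outer y))
    [set: node k m].

Lemma stack_above_inj : injective stack_above.
Proof. by move=> [i|i] [j|j] //= [->]. Qed.

Lemma stack_below_inj : injective stack_below.
Proof. by move=> x y [->]. Qed.

Lemma stack_outer_inj : injective stack_outer.
Proof. by move=> [i|i] [j|j] //= [->]. Qed.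

Let flip1 (D1 : diagram l m) (x : stack) : stack :=
  match x with
  | inl (inl _) => x
  | inl (inr i) => stack_above (partner (arcs D1) (inl i))
  | inr j => stack_above (partner (arcs D1) (inr j))
  end.

Let flip2 (D2 : diagram k l) (x : stack) : stack :=
  match x with
  | inl u => stack_below (partner (arcs D2) u)
  | inr _ => x
  end.

Let flip1E (D1 : diagram l m) u : flip1 D1 (stack_above u) = stack_above (partner (arcs D1) u).
Proof. by case: u. Qed.

Lemma comp_pairing (D1 : diagram l m) (D2 : diagram k l) : is_pairing (comp_arcs D1 D2).
Proof.
have symE : connect_sym (stack_adj D1 D2).
  by apply: sym_connect_sym => x y; rewrite /stack_adj setUC.
have eqE : {in [set: node k m] & &, equivalence_rel
    (fun x y => connect (stack_adj D1 D2) (stack_outer x) (stack_outer y))}.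
  move=> x y z _ _ _; split; first exact: connect0.
  by move=> xy; rewrite (same_connect symE xy).
apply/andP; split; first exact: equivalence_partitionP.
apply/forall_inP=> _ /imsetP[x _ ->]; apply/eqP.
rewrite -(card_imset _ stack_outer_inj).
pose s1 := flip1 D1; pose s2 := flip2 D2.
have s1K : involutive s1.
  case=> [[i|i]|i] //=; rewrite /s1 /= flip1E partnerK //; exact: arcsP.
have s2K : involutive s2.
  case=> [u|i] //=; rewrite /s2 /= partnerK //; exact: arcsP.
have s1fix u : s1 (stack_above u) != stack_above u.
  rewrite /s1 flip1E (inj_eq stack_above_inj) partner_neq //; exact: arcsP.
have s2fix u : s2 (stack_below u) != stack_below u.
  rewrite (inj_eq stack_below_inj) partner_neq //; exact: arcsP.
have s12 y : ~~ ((s1 y == y) && (s2 y == y)).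
  case: y => [u|j]; first by rewrite (negPf (s2fix u)) andbF.
  by rewrite (negPf (s1fix (inr j))).
have adjE y z : stack_adj D1 D2 y z = (z != y) && ((z == s1 y) || (z == s2 y)).
  rewrite /stack_adj inE; apply/orP/andP.
    case=> /mem_imset_pairing[]; rewrite ?arcsP //.
    - exact: stack_above_inj.
    - by move=> u -> ->; rewrite -flip1E s1fix eqxx.
    - exact: stack_below_inj.
    - move=> u -> ->; rewrite -[stack_below (partner _ _)]/(s2 (stack_below u)).
      by rewrite s2fix eqxx orbT.
  case=> ne /orP[] /eqP zE; rewrite {z}zE in ne *.
    case: y ne => [[i|i]|i] ne; first by rewrite eqxx in ne.
      left; apply/mem_imset_pairing; rewrite ?arcsP //.
        exact: stack_above_inj.
      by exists (inl i).
    left; apply/mem_imset_pairing; rewrite ?arcsP //.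
      exact: stack_above_inj.
    by exists (inr i).
  case: y ne => [u|i] ne; last by rewrite eqxx in ne.
  right; apply/mem_imset_pairing; rewrite ?arcsP //; last by exists u.
  exact: stack_below_inj.
have outE z : (z \in codom stack_outer) = (s1 z == z) || (s2 z == z).
  case: z => [[i|i]|i].
  - by rewrite eqxx (codom_f stack_outer (inl i)).
  - rewrite (negPf (s1fix (inl i))) (negPf (s2fix (inr i))).
    by apply/codomP=> -[[j|j]].
  - by rewrite /s2 /= eqxx orbT (codom_f stack_outer (inr i)).
have imE : stack_outer @: [set y in [set: node k m] |
      connect (stack_adj D1 D2) (stack_outer x) (stack_outer y)]
    = [set z | connect (stack_adj D1 D2) (stack_outer x) z
             & (s1 z == z) || (s2 z == z)].
  apply/setP=> z; rewrite !inE -outE; apply/imsetP/andP.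
    by case=> y; rewrite !inE => xy ->; rewrite codom_f.
  by case=> + /codomP[y zy]; rewrite zy => xy; exists y; rewrite ?inE.
rewrite imE; case: x {imE} => [i|i].
  exact: dihedral_card.
under eq_finset => z do rewrite orbC.
apply: dihedral_card => // [y|y z]; first by rewrite andbC.
by rewrite orbC adjE.
Qed.

Definition comp_diagram (D1 : diagram l m) (D2 : diagram k l) : diagram k m := Diagram (comp_pairing D1 D2).

End Composition.

Section Tensor.
Variables (k l k' l' : nat).

Definition left_node (x : node k l) : node (k + k') (l + l') :=
  match x with inl i => inl (lshift k' i) | inr j => inr (lshift l' j) end.

Definition right_node (x : node k' l') : node (k + k') (l + l') :=
  match x with inl i => inl (rshift k i) | inr j => inr (rshift l j) end.

Definition tens_arcs (D : diagram k l) (D' : diagram k' l') :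
    {set {set node (k + k') (l + l')}} :=
  [set left_node @: (B : {set _}) | B in arcs D]
    :|: [set right_node @: (B : {set _}) | B in arcs D'].

Lemma left_node_inj : injective left_node.
Proof.
by case=> i [] j //= [] /ord_inj ->.
Qed.

Lemma right_node_inj : injective right_node.
Proof.
by case=> i [] j //= [] /addnI/ord_inj ->.
Qed.

Lemma left_right_node x y : left_node x != right_node y.
Proof.
case: x y => i [] j //=; apply/eqP => -[] e;
have:= ltn_ord i; lia.
Qed.

Lemma node_splitP x :
  (exists u, x = left_node u) \/ (exists u, x = right_node u).
Proof.
case: x => i; rewrite -(splitK i); case: (split i) => j /=.
- by left; exists (inl j).
- by right; exists (inl j).
- by left; exists (inr j).
- by right; exists (inr j).
Qed.

Lemma tens_pairing D D' : is_pairing (tens_arcs D D').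
Proof.
case/andP: (arcsP D) => /and3P[/eqP covD tiD nD] /forall_inP cD.
case/andP: (arcsP D') => /and3P[/eqP covD' tiD' nD'] /forall_inP cD'.
apply/andP; split; last first.
  apply/forall_inP=> B /setUP[] /imsetP[C CD ->].
    by rewrite card_imset ?cD //; apply: left_node_inj.
  by rewrite card_imset ?cD' //; apply: right_node_inj.
apply/and3P; split.
- apply/eqP/setP=> x; rewrite inE; apply/bigcupP.
  case: (node_splitP x) => -[u ->].
    have /bigcupP[C CD uC] : u \in cover (arcs D) by rewrite covD inE.
    exists (left_node @: C); last exact: imset_f.
    by apply/setUP; left; apply: imset_f.
  have /bigcupP[C CD uC] : u \in cover (arcs D') by rewrite covD' inE.
  exists (right_node @: C); last exact: imset_f.
  by apply/setUP; right; apply: imset_f.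
- have disLR (B : {set node k l}) (C : {set node k' l'}) :
      [disjoint left_node @: B & right_node @: C].
    apply/pred0P=> z /=; apply/andP=> -[/imsetP[u _ ->] /imsetP[v _ /eqP]].
    by rewrite (negPf (left_right_node u v)).
  apply/trivIsetP=> _ _ /setUP[] /imsetP[B BD ->] /setUP[] /imsetP[C CD ->] ne.
  + rewrite imset_disjoint; last exact: left_node_inj.
    by apply: (trivIsetP tiD) => //; apply: contraNneq ne => ->.
  + exact: disLR.
  + by rewrite disjoint_sym disLR.
  + rewrite imset_disjoint; last exact: right_node_inj.
    by apply: (trivIsetP tiD') => //; apply: contraNneq ne => ->.
- apply/setUP=> -[] /imsetP[B BD /esym/eqP]; rewrite imset_eq0 => /eqP B0.
    by rewrite -B0 BD in nD.
  by rewrite -B0 BD in nD'.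
Qed.

Definition tens_diagram D D' : diagram (k + k') (l + l') :=
  Diagram (tens_pairing D D').

End Tensor.

Section BasicDiagrams.

Definition perm_partner r (s : 'S_r) (x : node r r) : node r r :=
  match x with inl i => inr (s i) | inr j => inl ((s^-1)%g j) end.

Lemma perm_partnerK r (s : 'S_r) : involutive (perm_partner s).
Proof. by case=> i /=; rewrite ?permK ?permKV. Qed.

Lemma perm_partner_neq r (s : 'S_r) x : perm_partner s x != x.
Proof. by case: x. Qed.

(* The lower node [i] is joined to the upper node [s i]. *)
Definition perm_diagram r (s : 'S_r) : diagram r r :=
  Diagram (involution_pairing (perm_partnerK s) (@perm_partner_neq r s)).

(* The [r]-fold juxtaposition of [diagram_I]. *)
Definition id_diagram r : diagram r r := perm_diagram (1%g : 'S_r).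

Lemma setT_pairing (T : finType) : #|T| = 2%N -> is_pairing [set [set: T]].
Proof.
move=> T2; apply/andP; split; last first.
  by apply/forall_inP=> _ /set1P->; rewrite cardsT T2.
rewrite /partition /cover big_set1 eqxx trivIset1 in_set1 /=.
by apply/eqP=> /(congr1 (fun B : {set T} => #|B|)); rewrite cards0 cardsT T2.
Qed.

Lemma card_node k l : #|{: node k l}| = (k + l)%N.
Proof. by rewrite card_sum !card_ord. Qed.

Definition diagram_I : diagram 1 1 := id_diagram 1.
Definition diagram_X : diagram 2 2 := perm_diagram (tperm ord0 ord_max).
Definition diagram_A : diagram 2 0 := Diagram (setT_pairing (card_node 2 0)).
Definition diagram_U : diagram 0 2 := Diagram (setT_pairing (card_node 0 2)).

End BasicDiagrams.

Notation brauer K k l := {ffun diagram k l -> K^o}.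

Section BrauerAlgebra.
Variable K : fieldType.

Definition diag k l (D : diagram k l) : brauer K k l :=
  [ffun D' => (D' == D)%:R].

Variable delta : K.

Definition bcomp k l m (x : brauer K l m) (y : brauer K k l) : brauer K k m :=
  \sum_(D1 : diagram l m) \sum_(D2 : diagram k l)
    (x D1 * y D2 * delta ^+ closed_loops D1 D2) *: diag (comp_diagram D1 D2).

Definition btens k l k' l' (x : brauer K k l) (y : brauer K k' l') :
    brauer K (k + k') (l + l') :=
  \sum_(D : diagram k l) \sum_(D' : diagram k' l')
    (x D * y D') *: diag (tens_diagram D D').

Definition cast_brauer r s (e : r = s) (x : brauer K r r) : brauer K s s :=
  ecast m (brauer K m m) e x.

Definition extend s r (le_sr : (s <= r)%N) (x : brauer K s s) : brauer K r r :=
  cast_brauer (subnKC le_sr) (btens x (diag (id_diagram (r - s)))).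

Definition e_diagram i j : diagram (i + 2 + j) (i + 2 + j) :=
  tens_diagram
    (tens_diagram (id_diagram i) (comp_diagram diagram_U diagram_A))
    (id_diagram j).

Lemma e_gen_index r i :
  ((i.-1 + 2 + (r - i.+1))%N == r) = ((0 < i)%N && (i < r)%N).
Proof. by apply/eqP/andP; lia. Qed.

(* The nodes are counted from 1 here: the arcs of the [i]-th generator join the
   nodes [i] and [i + 1] of each row. It is 0 unless 0 < i < r. *)
Definition e_gen r i : brauer K r r :=
  if (i.-1 + 2 + (r - i.+1))%N =P r is ReflectT e
  then cast_brauer e (diag (e_diagram i.-1 (r - i.+1))) else 0.

Definition sym_sum r : brauer K r r := \sum_(s : 'S_r) diag (perm_diagram s).

Record two_sided_ideal r (J : brauer K r r -> Prop) : Prop := {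
  ideal0 : J 0;
  idealD : forall x y, J x -> J y -> J (x + y);
  idealZ : forall (c : K) x, J x -> J (c *: x);
  idealMl : forall y x, J x -> J (bcomp y x);
  idealMr : forall y x, J x -> J (bcomp x y)
}.

Definition in_generated_ideal r (g x : brauer K r r) : Prop :=
  forall J : brauer K r r -> Prop, two_sided_ideal J -> J g -> J x.

End BrauerAlgebra.

Section Phi.
Variables (K : fieldType) (n : nat).

Definition brauer_parameter : K := - (2 * n)%:R.

Local Notation mul := (@bcomp K brauer_parameter n.+1 n.+1 n.+1).

Definition E_elt k : brauer K n.+1 n.+1 :=
  \big[mul / diag K (id_diagram n.+1)]_(1 <= j < k.+1)
     e_gen K n.+1 (n + 2 - 2 * j).

Definition Xi_elt k : brauer K n.+1 n.+1 :=
  mul (mul (sym_sum K n.+1) (E_elt k)) (sym_sum K n.+1).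

Definition Phi_coef k : K :=
  (((2 ^ k * k`!) ^ 2 * (n + 1 - 2 * k)`!)%N%:R)^-1.

Definition Phi_elt : brauer K n.+1 n.+1 :=
  \sum_(0 <= k < ((n + 1) %/ 2).+1) Phi_coef k *: Xi_elt k.

End Phi.

(* The [r]-th tensor power of K^N, in coordinates: the value at [t] is the
   coefficient on the tensor product of the standard basis vectors number
   t 0, ..., t (r - 1). *)
Notation tpow K N r := {ffun {ffun 'I_r -> 'I_N} -> K^o}.

Section TensorPower.
Variables (K : fieldType) (N : nat).

Definition tens r s (u : tpow K N r) (v : tpow K N s) : tpow K N (r + s) :=
  [ffun t : {ffun 'I_(r + s) -> 'I_N} =>
     u [ffun i => t (lshift s i)] * v [ffun j => t (rshift r j)]].

(* The identifications of K with the 0-th and of K^N with the first power. *)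
Definition tens_scalar (c : K) : tpow K N 0 := [ffun => c].
Definition tens_vector (v : 'rV[K]_N) : tpow K N 1 :=
  [ffun t : {ffun 'I_1 -> 'I_N} => v 0 (t ord0)].

Definition tens2 (v w : 'rV[K]_N) : tpow K N 2 :=
  tens (tens_vector v) (tens_vector w).

(* The action of [g] on the tensor power, where [g] acts on K^N by v |-> v *m g. *)
Definition tens_act (g : 'M[K]_N) r (u : tpow K N r) : tpow K N r :=
  [ffun t : {ffun 'I_r -> 'I_N} =>
     \sum_(s : {ffun 'I_r -> 'I_N}) (\prod_i g (s i) (t i)) * u s].

End TensorPower.

Section Functor.
Variables (K : fieldType) (n : nat).
Local Notation V := 'rV[K]_(2 * n).
Local Notation T r := (tpow K (2 * n) r).
Variable form : {skew_symmetric V}.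

Definition in_Sp (g : 'M[K]_(2 * n)) : Prop :=
  g \in unitmx /\ forall v w : V, form (v *m g) (w *m g) = form v w.

Definition dual_bases (b bbar : (2 * n).-tuple V) : Prop :=
  basis_of fullv b /\
  forall i j, form (tnth bbar i) (tnth b j) = (i == j)%:R.

Record is_brauer_functor (b bbar : (2 * n).-tuple V)
    (F : forall k l, {linear brauer K k l -> 'Hom(T k, T l)}) : Prop := {
  functor_Sp : forall k l (x : brauer K k l) g u, in_Sp g ->
    F k l x (tens_act g u) = tens_act g (F k l x u);
  functor_id : forall r, F r r (diag K (id_diagram r)) = \1%VF;
  functor_comp : forall k l m (x : brauer K l m) (y : brauer K k l),
    F k m (bcomp (brauer_parameter K n) x y) = (F l m x \o F k l y)%VF;
  functor_tens : forall k l k' l' (D : diagram k l) (D' : diagram k' l') u v,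
    F (k + k') (l + l') (diag K (tens_diagram D D')) (tens u v)
      = tens (F k l (diag K D) u) (F k' l' (diag K D') v);
  functor_I : F 1 1 (diag K diagram_I) = \1%VF;
  functor_X : forall v w : V,
    F 2 2 (diag K diagram_X) (tens2 v w) = - tens2 w v;
  functor_U :
    F 0 2 (diag K diagram_U) (tens_scalar (2 * n) 1)
      = \sum_i tens2 (tnth b i) (tnth bbar i);
  functor_A : forall v w : V,
    F 2 0 (diag K diagram_A) (tens2 v w) = tens_scalar (2 * n) (form v w)
}.

End Functor.

(* Main.v *)
Require Import Defs.
From HB Require Import structures.
From mathcomp Require Import all_boot all_order all_fingroup all_algebra.
From mathcomp Require Import zify ring.
Set Implicit Arguments.
Unset Strict Implicit.
Unset Printing Implicit Defensive.
Import Order.TTheory GRing.Theory Num.Theory.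
Local Open Scope ring_scope.

(** Both sides of the theorem become combinatorics of perfect matchings once two
    facts are known.

    The element Phi is the sum of all (n+1, n+1) diagrams ([Phi_eltE]).  Row
    permutations act transitively on the diagrams with k horizontal arcs in each
    row, so the product Xi_k is a multiple of the sum of these, and the multiple
    is found by double counting: trading two horizontal arcs for two vertical
    ones relates the numbers of diagrams with k + 1 and with k horizontal arcs
    ([diagrams_with_rec]), which makes it the inverse of a_k.

    Bending the upper nodes of a diagram down turns its image under the functor
    into a multilinear form on V, and no information is lost ([kernel_bend]).
    As the crossing acts by minus the flip, relabelling the nodes of the bent
    diagram changes the form by the sign of the relabelling and permutes its
    arguments ([functor_relabel]).  Two consequences carry the proof.  The form
    of the sum of all (n+1, n+1) diagrams is alternating in 2n + 2 arguments from
    a space of dimension 2n, so this sum lies in the kernel ([sum_all_kernel]).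
    And the form of a single diagram is, up to sign, the product of the values of
    the symplectic form along its arcs, so it is non-zero on given vectors
    exactly if no arc joins two orthogonal ones ([functor_neq0]).

    Now put the 2r nodes on a line.  If n + 1 arcs of a diagram are nested into
    each other, the sum over all ways to rematch their 2n + 2 ends belongs to the
    ideal generated by Phi: when the ends are evenly distributed over the rows
    this sum is Phi beside other strands, up to permutations, and any other
    distribution is reached by multiplying with diagrams that carry a horizontal
    arc in each row ([local_sum_ideal]).  By a rearrangement argument the nested
    matching is the unique extremal one in that sum for the tightness, the sum of
    the products of the positions of matched nodes ([nested_minimal]).  Hence,
    modulo the ideal, every element is a combination of the diagrams without
    n + 1 nested arcs ([straightens_diag]).

    The images of those diagrams are linearly independent ([shallow_free]).
    Give every arc its nesting depth i, which is at most n, and evaluate on the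
    symplectic vectors p_i at its left and q_i at its right end.  The diagrams
    whose form does not vanish there match the left ends of each depth with the
    right ends of the same depth, and the original diagram is the one of largest
    tightness among them, because arcs of equal depth are never nested
    ([compatible_maximal]).  So the matrix of values is triangular.

    An element of the kernel is therefore congruent to zero modulo the ideal, and
    for r at most n there is no room for n + 1 nested arcs at all. *)

(** * Diagrams as fixed-point-free involutions *)

Section Mate.
Variables k l : nat.
Implicit Types (D : diagram k l) (x y : node k l) (p q : {perm node k l}).

Definition mate D x := partner (arcs D) x.

Lemma mateK D : involutive (mate D).
Proof. exact: partnerK (arcsP D). Qed.

Lemma mate_neq D x : mate D x != x.
Proof. exact: partner_neq (arcsP D) x. Qed.

Lemma mate_inj D : injective (mate D).
Proof. exact: inv_inj (mateK D). Qed.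

Lemma arc_mate D x y : ([set x; y] \in arcs D) = (y == mate D x).
Proof. exact: pairing_partner (arcsP D) x y. Qed.

Lemma eq_diagram D D' : mate D =1 mate D' -> D = D'.
Proof.
move=> eqm; apply/val_inj/setP=> B /=.
suff sub (E E' : diagram k l) : mate E =1 mate E' ->
    forall C, C \in arcs E -> C \in arcs E'.
  by apply/idP/idP; apply: sub => // x.
move=> {}eqm C CE.
have /andP[_ /forall_inP/(_ _ CE)/cards2P[x [y [_ CE2]]]] := arcsP E.
by move: CE; rewrite CE2 !arc_mate eqm.
Qed.

Lemma mate_involution f (fK : involutive f) (fx : forall x, f x != x) :
  mate (Diagram (involution_pairing fK fx)) =1 f.
Proof. by move=> x; apply/esym/eqP; rewrite -arc_mate /=; apply/imsetP; exists x. Qed.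

Section Relabel.
Variables (p : {perm node k l}) (D : diagram k l).
Let f x := p (mate D ((p^-1)%g x)).
Let fK : involutive f.
Proof. by move=> x; rewrite /f permK mateK permKV. Qed.
Let fx x : f x != x.
Proof. by rewrite -{2}(permKV p x) (inj_eq perm_inj) mate_neq. Qed.

Definition relabel : diagram k l := Diagram (involution_pairing fK fx).

Lemma mate_relabel x : mate relabel x = p (mate D ((p^-1)%g x)).
Proof. exact: mate_involution. Qed.

Lemma mate_relabelE x : mate relabel (p x) = p (mate D x).
Proof. by rewrite mate_relabel permK. Qed.
End Relabel.

Lemma relabel1 D : relabel 1 D = D.
Proof. by apply: eq_diagram => x; rewrite mate_relabel invg1 !perm1. Qed.

Lemma relabelM p q D : relabel (p * q) D = relabel q (relabel p D).
Proof.
by apply: eq_diagram => x; rewrite !mate_relabel invMg !permM.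
Qed.

Lemma relabelK p : cancel (relabel p) (relabel p^-1).
Proof. by move=> D; rewrite -relabelM mulgV relabel1. Qed.

Lemma relabelKV p : cancel (relabel p^-1) (relabel p).
Proof. by move=> D; rewrite -relabelM mulVg relabel1. Qed.

Lemma relabel_bij p : bijective (relabel p).
Proof. exact: Bijective (relabelK p) (relabelKV p). Qed.

Lemma relabel_tpermK x y : involutive (relabel (tperm x y)).
Proof. by move=> D; rewrite -relabelM tperm2 relabel1. Qed.

Definition is_upper x := if x is inr _ then true else false.

End Mate.

Definition rows_perm_fun k l (s : 'S_k) (t : 'S_l) (x : node k l) : node k l :=
  match x with inl i => inl (s i) | inr j => inr (t j) end.

Lemma rows_perm_inj k l (s : 'S_k) (t : 'S_l) : injective (rows_perm_fun s t).
Proof. by move=> [i|i] [j|j] //= [] /perm_inj ->. Qed.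

Definition rows_perm k l (s : 'S_k) (t : 'S_l) : {perm node k l} :=
  perm (@rows_perm_inj k l s t).

Lemma rows_permE k l (s : 'S_k) (t : 'S_l) x :
  rows_perm s t x = rows_perm_fun s t x.
Proof. exact: permE. Qed.

Lemma mate_perm r (s : 'S_r) x : mate (perm_diagram s) x = perm_partner s x.
Proof. exact: mate_involution. Qed.

(** * Composites of diagrams that close no loop *)

Section Connect.
Variables (k l m : nat) (D1 : diagram l m) (D2 : diagram k l).
Local Notation conn := (connect (stack_adj D1 D2)).

Lemma conn_sym : connect_sym (stack_adj D1 D2).
Proof. by apply: sym_connect_sym => x y; rewrite /stack_adj setUC. Qed.

Lemma conn_above x : conn (stack_above k x) (stack_above k (mate D1 x)).
Proof.
apply: connect1; rewrite /stack_adj inE; apply/orP; left.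
apply/mem_imset_pairing; [exact: stack_above_inj | exact: arcsP |].
by exists x.
Qed.

Lemma conn_below x : conn (stack_below m x) (stack_below m (mate D2 x)).
Proof.
apply: connect1; rewrite /stack_adj inE; apply/orP; right.
apply/mem_imset_pairing; [exact: stack_below_inj | exact: arcsP |].
by exists x.
Qed.

Definition composes_to (D : diagram k m) :=
  comp_diagram D1 D2 = D /\ closed_loops D1 D2 = 0%N.

(** As both sides are perfect matchings, it is enough that every arc of the
    expected composite is realised by some path in the stack; a loop would be a
    component that no outer node reaches. *)
Lemma composesP D :
    (forall x, conn (stack_outer l x) (stack_outer l (mate D x))) ->
    (forall i : 'I_l, exists x, conn (stack_outer l x) (inl (inr i))) ->
  composes_to D.
Proof.
move=> connD midD; split.
  apply: eq_diagram => x; apply/esym/eqP; rewrite -arc_mate.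
  pose B := [set y in [set: node k m] |
    conn (stack_outer l x) (stack_outer l y)].
  have BC : B \in comp_arcs D1 D2 by apply: imset_f; rewrite inE.
  suff -> : [set x; mate D x] = B by [].
  have /andP[_ /forall_inP/(_ _ BC)/eqP cardB] := comp_pairing D1 D2.
  apply/eqP; rewrite eqEcard cardB cards2 [x == _]eq_sym mate_neq andbT.
  by apply/subsetP=> y /set2P[]->; rewrite !inE ?connect0 ?connD.
apply/eqP; rewrite cards_eq0 -subset0; apply/subsetP=> C; rewrite !inE.
case/andP=> /imsetP[y _ ->]; suff [x xy] : exists x, conn (stack_outer l x) y.
  move/pred0P/(_ (stack_outer l x)); rewrite /= codom_f andbT !inE conn_sym.
  by rewrite xy.
case: y => [[i|i]|j]; [by exists (inl i); apply: connect0 | exact: midD |].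
by exists (inr j); apply: connect0.
Qed.

End Connect.

Lemma composes_perm_l k l (s : 'S_l) (D : diagram k l) :
  composes_to (perm_diagram s) D (relabel (rows_perm 1 s) D).
Proof.
have out x : connect (stack_adj (perm_diagram s) D)
    (stack_below l x) (stack_outer l (rows_perm 1 s x)).
  rewrite rows_permE; case: x => j /=; first by rewrite perm1 connect0.
  by have := conn_above (perm_diagram s) D (inl j); rewrite mate_perm.
apply: composesP => [x|i]; last first.
  by exists (rows_perm 1 s (inr i)); rewrite conn_sym; apply: out.
rewrite -(permKV (rows_perm 1 s) x) mate_relabelE.
move: (_ x) => {}x; apply: connect_trans (out _); rewrite conn_sym.
by apply: connect_trans (out _); rewrite conn_sym; apply: conn_below.
Qed.

Lemma composes_perm_r k l (s : 'S_k) (D : diagram k l) :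
  composes_to D (perm_diagram s) (relabel (rows_perm s^-1 1) D).
Proof.
have out x : connect (stack_adj D (perm_diagram s))
    (stack_above k x) (stack_outer k (rows_perm s^-1 1 x)).
  rewrite rows_permE; case: x => j /=; last by rewrite perm1 connect0.
  by have := conn_below D (perm_diagram s) (inr j); rewrite mate_perm.
apply: composesP => [x|i]; last first.
  by exists (rows_perm s^-1 1 (inl i)); rewrite conn_sym; apply: out.
rewrite -(permKV (rows_perm s^-1 1) x) mate_relabelE.
move: (_ x) => {}x; apply: connect_trans (out _); rewrite conn_sym.
by apply: connect_trans (out _); rewrite conn_sym; apply: conn_above.
Qed.

(** The diagram of a contraction followed by an insertion in the positions
    [i] and [j]: the arcs [i]-[j] in both rows, all the other strands vertical. *)
Definition hook r (i j : 'I_r) : diagram r r :=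
  relabel (tperm (inr i) (inl j)) (id_diagram r).

Section Hook.
Variables (r : nat) (i j : 'I_r).
Hypothesis ij : i != j.

Lemma mate_hook_upper : mate (hook i j) (inr i) = inr j.
Proof.
by rewrite mate_relabel tpermV tpermL mate_perm /= perm1 tpermD.
Qed.

Lemma mate_hook_lower : mate (hook i j) (inl i) = inl j.
Proof.
rewrite mate_relabel tpermV (tpermD (z := inl i)) //; last by rewrite eq_sym.
by rewrite mate_perm /= perm1 tpermL.
Qed.

Lemma mate_hook_vert a : a != i -> a != j -> mate (hook i j) (inl a) = inr a.
Proof.
move=> ai aj.
rewrite mate_relabel tpermV (tpermD (z := inl a)) // 1?eq_sym //.
by rewrite mate_perm /= perm1 tpermD // 1?eq_sym.
Qed.

(** Cut the upper arc [i]-[j] together with any other arc [l]-[x] of [D] and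
    reconnect the ends crosswise, as [i]-[x] and [j]-[l]; this is the effect of
    the transposition of [i] and [l].  The lower arc of the hook then joins [x]
    and [l] again, and its upper arc restores [i]-[j]. *)
Lemma composes_hook_l (D : diagram r r) (l : node r r) :
    mate D (inr i) = inr j -> l != inr i -> l != inr j ->
  composes_to (hook i j) (relabel (tperm (inr i) l) D) D.
Proof.
move=> Dij li lj; set t := tperm (inr i) l; set D' := relabel t D.
pose c := connect (stack_adj (hook i j) D').
have out y : y != inr i -> y != inr j -> c (stack_outer r y) (stack_below r y).
  case: y => a /=; first by rewrite /c connect0.
  move=> ai aj; rewrite /c conn_sym.
  have := conn_above (hook i j) D' (inl a); rewrite mate_hook_vert //.
have cc a b : c a b -> c b a by rewrite /c conn_sym.
have Dji : mate D (inr j) = inr i by rewrite -Dij mateK.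
have Dl_i : mate D l != inr i by rewrite (inv_eq (@mateK _ _ D)) Dij.
have Dl_j : mate D l != inr j by rewrite (inv_eq (@mateK _ _ D)) Dji.
have D'i : mate D' (inr i) = mate D l.
  rewrite /D' -{1}(tpermR (inr i) l) mate_relabelE tpermD // 1?eq_sym //.
  exact: mate_neq.
have D'l : mate D' l = inr j.
  rewrite /D' -{1}(tpermL (inr i) l) mate_relabelE Dij tpermD //.
(* The path that replaces the arc l - x runs through the middle nodes j and i. *)
have mid_l : c (stack_below r l) (inl (inr j)).
  by have := conn_below (hook i j) D' l; rewrite D'l.
have mid_x : c (stack_below r (mate D l)) (inl (inr i)).
  apply: cc; have := conn_below (hook i j) D' (inr i); rewrite D'i; exact.
have mid_ij : c (inl (inr i)) (inl (inr j)).
  by have := conn_above (hook i j) D' (inl i); rewrite mate_hook_lower.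
have belowD y : y != inr i -> y != inr j ->
    c (stack_below r y) (stack_below r (mate D y)).
  move=> yi yj; have [->|yl] := eqVneq y l.
    apply: connect_trans mid_l _; apply: cc.
    exact: connect_trans mid_x mid_ij.
  have [->|yx] := eqVneq y (mate D l).
    rewrite mateK; apply: connect_trans mid_x _.
    by apply: connect_trans mid_ij _; apply: cc.
  have := conn_below (hook i j) D' y.
  suff -> : mate D' y = mate D y by [].
  rewrite mate_relabel tpermV !tpermD // 1?eq_sym // (inv_eq (@mateK _ _ D)) //.
  by rewrite Dij.
apply: composesP => [y|a]; last first.
  have [-> |ai] := eqVneq a i.
    by exists (mate D l); apply: connect_trans mid_x; apply: out.
  have [-> |aj] := eqVneq a j.
    by exists l; apply: connect_trans mid_l; apply: out.
  by exists (inr a); apply: out.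
have upij : c (stack_outer r (inr i)) (stack_outer r (inr j)).
  by have := conn_above (hook i j) D' (inr i); rewrite mate_hook_upper.
have [->|yi] := eqVneq y (inr i); first by rewrite Dij.
have [->|yj] := eqVneq y (inr j); first by rewrite Dji; apply: cc.
apply: connect_trans (out _ yi yj) _; apply: connect_trans (belowD _ yi yj) _.
apply/cc/out; first by rewrite (inv_eq (@mateK _ _ D)) Dij.
by rewrite (inv_eq (@mateK _ _ D)) Dji.
Qed.

(** The mirror image: the cut arc lies in the lower row. *)
Lemma composes_hook_r (D : diagram r r) (l : node r r) :
    mate D (inl i) = inl j -> l != inl i -> l != inl j ->
  composes_to (relabel (tperm (inl i) l) D) (hook i j) D.
Proof.
move=> Dij li lj; set t := tperm (inl i) l; set D' := relabel t D.
pose c := connect (stack_adj D' (hook i j)).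
have out y : y != inl i -> y != inl j -> c (stack_outer r y) (stack_above r y).
  case: y => a /=; last by rewrite /c connect0.
  move=> ai aj.
  have := conn_below D' (hook i j) (inl a); rewrite mate_hook_vert //.
have cc a b : c a b -> c b a by rewrite /c conn_sym.
have Dji : mate D (inl j) = inl i by rewrite -Dij mateK.
have Dl_i : mate D l != inl i by rewrite (inv_eq (@mateK _ _ D)) Dij.
have Dl_j : mate D l != inl j by rewrite (inv_eq (@mateK _ _ D)) Dji.
have D'i : mate D' (inl i) = mate D l.
  rewrite /D' -{1}(tpermR (inl i) l) mate_relabelE tpermD // 1?eq_sym //.
  exact: mate_neq.
have D'l : mate D' l = inl j.
  rewrite /D' -{1}(tpermL (inl i) l) mate_relabelE Dij tpermD //.
have mid_l : c (stack_above r l) (inl (inr j)).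
  by have := conn_above D' (hook i j) l; rewrite D'l.
have mid_x : c (stack_above r (mate D l)) (inl (inr i)).
  apply: cc; have := conn_above D' (hook i j) (inl i); rewrite D'i; exact.
have mid_ij : c (inl (inr i)) (inl (inr j)).
  by have := conn_below D' (hook i j) (inr i); rewrite mate_hook_upper.
have aboveD y : y != inl i -> y != inl j ->
    c (stack_above r y) (stack_above r (mate D y)).
  move=> yi yj; have [->|yl] := eqVneq y l.
    apply: connect_trans mid_l _; apply: cc.
    exact: connect_trans mid_x mid_ij.
  have [->|yx] := eqVneq y (mate D l).
    rewrite mateK; apply: connect_trans mid_x _.
    by apply: connect_trans mid_ij _; apply: cc.
  have := conn_above D' (hook i j) y.
  suff -> : mate D' y = mate D y by [].
  rewrite mate_relabel tpermV !tpermD // 1?eq_sym // (inv_eq (@mateK _ _ D)) //.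
  by rewrite Dij.
apply: composesP => [y|a]; last first.
  have [-> |ai] := eqVneq a i.
    by exists (mate D l); apply: connect_trans mid_x; apply: out.
  have [-> |aj] := eqVneq a j.
    by exists l; apply: connect_trans mid_l; apply: out.
  by exists (inl a); apply: out.
have lowij : c (stack_outer r (inl i)) (stack_outer r (inl j)).
  by have := conn_below D' (hook i j) (inl i); rewrite mate_hook_lower.
have [->|yi] := eqVneq y (inl i); first by rewrite Dij.
have [->|yj] := eqVneq y (inl j); first by rewrite Dji; apply: cc.
apply: connect_trans (out _ yi yj) _; apply: connect_trans (aboveD _ yi yj) _.
apply/cc/out; first by rewrite (inv_eq (@mateK _ _ D)) Dij.
by rewrite (inv_eq (@mateK _ _ D)) Dji.
Qed.

End Hook.

Section TensorMate.
Variables (k l k' l' : nat) (D : diagram k l) (D' : diagram k' l').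

Lemma mate_tens_left x :
  mate (tens_diagram D D') (left_node k' l' x) = left_node k' l' (mate D x).
Proof.
apply/esym/eqP; rewrite -arc_mate inE; apply/orP; left.
apply/mem_imset_pairing; [exact: left_node_inj | exact: arcsP |].
by exists x.
Qed.

Lemma mate_tens_right x :
  mate (tens_diagram D D') (right_node k l x) = right_node k l (mate D' x).
Proof.
apply/esym/eqP; rewrite -arc_mate inE; apply/orP; right.
apply/mem_imset_pairing; [exact: right_node_inj | exact: arcsP |].
by exists x.
Qed.

End TensorMate.

Lemma composes_UA : composes_to diagram_U diagram_A (hook ord0 ord_max).
Proof.
have mateU x y : x != y -> mate diagram_U x = y.
  move=> xy; apply/esym/eqP; rewrite -arc_mate /= inE eqEcard subsetT.
  by rewrite cardsT card_node cards2 xy.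
have mateA x y : x != y -> mate diagram_A x = y.
  move=> xy; apply/esym/eqP; rewrite -arc_mate /= inE eqEcard subsetT.
  by rewrite cardsT card_node cards2 xy.
apply: composesP => [x|[]//]; have /= low := conn_below diagram_U diagram_A.
have /= up := conn_above diagram_U diagram_A.
have {}low (a b : 'I_2) : a != b -> connect (stack_adj diagram_U diagram_A)
  (stack_outer 0 (inl a)) (stack_outer 0 (inl b)).
  move=> ab; have := low (inl a); rewrite (mateA _ (inl b)) //.
have {}up (a b : 'I_2) : a != b -> connect (stack_adj diagram_U diagram_A)
  (stack_outer 0 (inr a)) (stack_outer 0 (inr b)).
  move=> ab; have := up (inr a); rewrite (mateU _ (inr b)) //.
have ord2 (a : 'I_2) : a = ord0 \/ a = ord_max.
  by case: a => [[|[|//]] ?]; [left|right]; apply: val_inj.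
have ne : (ord0 : 'I_2) != ord_max by [].
case: x => a; case: (ord2 a) => ->.
- by rewrite mate_hook_lower //; apply: low.
- rewrite -{2}(mate_hook_lower ne) mateK; exact: low.
- by rewrite mate_hook_upper //; apply: up.
- rewrite -{2}(mate_hook_upper ne) mateK; exact: up.
Qed.

(** * Bilinearity of the composition *)

Section Coefficients.
Variables (K : fieldType) (k l : nat).
Implicit Types (x y : brauer K k l) (D : diagram k l).

(** Reading a coefficient in [K] rather than in the module [K^o] keeps the two
    structures apart in computations. *)
Definition bcoef x D : K := x D.

Lemma bcoefD x y D : bcoef (x + y) D = bcoef x D + bcoef y D.
Proof. by rewrite /bcoef ffunE. Qed.

Lemma bcoefZ c x D : bcoef (c *: x) D = c * bcoef x D.
Proof. by rewrite /bcoef ffunE. Qed.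

Lemma bcoef0 D : bcoef 0 D = 0.
Proof. by rewrite /bcoef ffunE. Qed.

Lemma bcoef_diag D' D : bcoef (diag K D') D = (D == D')%:R.
Proof. by rewrite /bcoef ffunE. Qed.

Lemma bcoef_sum I (r : seq I) (P : pred I) (f : I -> brauer K k l) D :
  bcoef (\sum_(i <- r | P i) f i) D = \sum_(i <- r | P i) bcoef (f i) D.
Proof.
by apply: (big_morph (bcoef^~ D)) => [u v|]; [exact: bcoefD | exact: bcoef0].
Qed.

Lemma bcoef_inj x y : bcoef x =1 bcoef y -> x = y.
Proof. by move=> e; apply/ffunP. Qed.

Lemma sum_diag_bcoef (P : pred (diagram k l)) (f : diagram k l -> K) D :
  bcoef (\sum_(D' | P D') f D' *: diag K D') D = if P D then f D else 0.
Proof.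
rewrite bcoef_sum; under eq_bigr do rewrite bcoefZ bcoef_diag.
rewrite big_mkcond (bigD1 D) //= eqxx big1 ?addr0; first by rewrite mulr1.
by move=> D' /negPf ne; rewrite eq_sym ne mulr0 if_same.
Qed.

Lemma brauerE x : x = \sum_D bcoef x D *: diag K D.
Proof. by apply: bcoef_inj => D; rewrite sum_diag_bcoef. Qed.

End Coefficients.

Section Bilinear.
Variables (K : fieldType) (delta : K).

Section Comp.
Variables k l m : nat.
Implicit Types (x : brauer K l m) (y : brauer K k l).
Local Notation "x ** y" := (bcomp delta x y) (at level 40).

Lemma bcompE x y :
  x ** y = \sum_(D1 : diagram l m) \sum_(D2 : diagram k l)
    (bcoef x D1 * bcoef y D2 * delta ^+ closed_loops D1 D2)
      *: diag K (comp_diagram D1 D2).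
Proof. by []. Qed.

Lemma bcomp_linearl c x x' y : (c *: x + x') ** y = c *: (x ** y) + x' ** y.
Proof.
rewrite !bcompE scaler_sumr -big_split /=; apply: eq_bigr => D1 _.
rewrite scaler_sumr -big_split /=; apply: eq_bigr => D2 _.
rewrite bcoefD bcoefZ scalerA -scalerDl; congr (_ *: _).
by rewrite !mulrDl !mulrA.
Qed.

Lemma bcomp_linearr c x y y' : x ** (c *: y + y') = c *: (x ** y) + x ** y'.
Proof.
rewrite !bcompE scaler_sumr -big_split /=; apply: eq_bigr => D1 _.
rewrite scaler_sumr -big_split /=; apply: eq_bigr => D2 _.
rewrite bcoefD bcoefZ scalerA -scalerDl; congr (_ *: _).
by rewrite mulrDr mulrDl mulrCA !mulrA.
Qed.

Lemma bcomp0l y : (0 : brauer K l m) ** y = 0.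
Proof.
set u := _ ** y.
by apply: (addrI u); rewrite -{1}[u]scale1r -bcomp_linearl scaler0 !addr0.
Qed.

Lemma bcomp0r x : x ** (0 : brauer K k l) = 0.
Proof.
set u := x ** _.
by apply: (addrI u); rewrite -{1}[u]scale1r -bcomp_linearr scaler0 !addr0.
Qed.

Lemma bcomp_suml I (r : seq I) (P : pred I) (f : I -> brauer K l m) y :
  (\sum_(i <- r | P i) f i) ** y = \sum_(i <- r | P i) (f i ** y).
Proof.
apply: (big_morph (fun x => x ** y)) => [u v|]; last exact: bcomp0l.
by rewrite -[u]scale1r bcomp_linearl !scale1r.
Qed.

Lemma bcomp_sumr I (r : seq I) (P : pred I) (f : I -> brauer K k l) x :
  x ** (\sum_(i <- r | P i) f i) = \sum_(i <- r | P i) (x ** f i).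
Proof.
apply: (big_morph (fun y => x ** y)) => [u v|]; last exact: bcomp0r.
by rewrite -[u]scale1r bcomp_linearr !scale1r.
Qed.

Lemma bcomp_diag (D1 : diagram l m) (D2 : diagram k l) :
  diag K D1 ** diag K D2
    = delta ^+ closed_loops D1 D2 *: diag K (comp_diagram D1 D2).
Proof.
rewrite bcompE (bigD1 D1 isT) /= [X in X + _](bigD1 D2 isT) /=.
rewrite [X in _ + X + _]big1; last first.
  by move=> D /negPf ne; rewrite !bcoef_diag ne mulr0 mul0r scale0r.
rewrite [X in _ + X]big1; last first.
  move=> D /negPf ne; apply: big1 => D' _.
  by rewrite !bcoef_diag ne !mul0r scale0r.
by rewrite !addr0 !bcoef_diag !eqxx !mul1r.
Qed.

Lemma bcomp_composes (D1 : diagram l m) (D2 : diagram k l) D :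
  composes_to D1 D2 D -> diag K D1 ** diag K D2 = diag K D.
Proof. by case=> <- loops0; rewrite bcomp_diag loops0 scale1r. Qed.

End Comp.

Section Tens.
Variables k l k' l' : nat.
Implicit Types (x : brauer K k l) (y : brauer K k' l').

Lemma btensE x y :
  btens x y = \sum_(D : diagram k l) \sum_(D' : diagram k' l')
    (bcoef x D * bcoef y D') *: diag K (tens_diagram D D').
Proof. by []. Qed.

Lemma btens_linearl c x x' y : btens (c *: x + x') y = c *: btens x y + btens x' y.
Proof.
rewrite !btensE scaler_sumr -big_split /=; apply: eq_bigr => D1 _.
rewrite scaler_sumr -big_split /=; apply: eq_bigr => D2 _.
rewrite bcoefD bcoefZ scalerA -scalerDl; congr (_ *: _).
by rewrite mulrDl mulrA.
Qed.

Lemma btens0l y : btens (0 : brauer K k l) y = 0.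
Proof.
set u := btens _ _.
by apply: (addrI u); rewrite -{1}[u]scale1r -btens_linearl scaler0 !addr0.
Qed.

Lemma btens_suml I (r : seq I) (P : pred I) (f : I -> brauer K k l) y :
  btens (\sum_(i <- r | P i) f i) y = \sum_(i <- r | P i) btens (f i) y.
Proof.
apply: (big_morph (fun x => btens x y)) => [u v|]; last exact: btens0l.
by rewrite -[u]scale1r btens_linearl !scale1r.
Qed.

Lemma btens_diag (D : diagram k l) (D' : diagram k' l') :
  btens (diag K D) (diag K D') = diag K (tens_diagram D D').
Proof.
rewrite btensE (bigD1 D isT) /= [X in X + _](bigD1 D' isT) /=.
rewrite [X in _ + X + _]big1; last first.
  by move=> E /negPf ne; rewrite !bcoef_diag ne mulr0 scale0r.
rewrite [X in _ + X]big1; last first.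
  move=> E /negPf ne; apply: big1 => E' _.
  by rewrite !bcoef_diag ne !mul0r scale0r.
by rewrite !addr0 !bcoef_diag !eqxx !mul1r scale1r.
Qed.

End Tens.

End Bilinear.

(** * Transitivity of relabellings *)

(** As long as the diagrams disagree somewhere, the equality of the counts
    provides an arc of [D'] with the colours of a given arc of [D], both in the
    region of disagreement; two colour-preserving transpositions within that
    region move the former onto the latter. *)
Lemma relabel_transitive k l (C : eqType) (c : node k l -> C) (D D' : diagram k l) :
    (forall a b, #|[set x | (c x == a) && (c (mate D x) == b)]|
               = #|[set x | (c x == a) && (c (mate D' x) == b)]|) ->
  exists2 p : {perm node k l}, (forall x, c (p x) = c x) & D = relabel p D'.
Proof.
have [n] := ubnP #|[set x | mate D x != mate D' x]|.
elim: n D' => // n IHn D' leZ eq_c; set Z := [set x | _] in leZ.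
have [Z0|[x xZ]] := set_0Vmem Z.
  exists 1%g => [x|]; first by rewrite perm1.
  rewrite relabel1; apply: eq_diagram => x; apply/eqP.
  by apply: contraTT isT => ne; have := in_set0 x; rewrite -Z0 inE ne.
pose y := mate D x; pose AD (E : diagram k l) :=
  [set u | (c u == c x) && (c (mate E u) == c y)].
(* Outside Z the two diagrams have the same arcs, so inside Z they have equally
   many arcs of each kind. *)
have AZ : #|AD D :&: Z| = #|AD D' :&: Z|.
  have := eq_c (c x) (c y); rewrite -/(AD D) -/(AD D').
  rewrite -(cardsID Z (AD D)) -(cardsID Z (AD D')).
  suff -> : AD D :\: Z = AD D' :\: Z by move/addIn.
  by apply/setP=> u; rewrite !inE negbK; case: eqP => // ->.
have : (0 < #|AD D' :&: Z|)%N.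
  by rewrite -AZ; apply/card_gt0P; exists x; rewrite 2!inE !eqxx xZ.
case/card_gt0P=> x'; rewrite 2!inE -andbA => /and3P[/eqP cx' /eqP cy' x'Z].
pose y' := mate D' x'.
have ZD u : (mate D u \in Z) = (u \in Z).
  by rewrite !inE mateK eq_sym (inv_eq (@mateK _ _ D')) eq_sym.
have ZD' u : (mate D' u \in Z) = (u \in Z).
  by rewrite !inE mateK (inv_eq (@mateK _ _ D)) eq_sym.
pose y1 := tperm x' x y'.
have ct u v w : c u = c v -> c (tperm u v w) = c w by move=> e; case: tpermP => [->|->|].
have cy1 : c y1 = c y by rewrite ct // cy'.
have yZ : y \in Z by rewrite ZD.
have y'Z : y' \in Z by rewrite ZD'.
have tZ u v w : u \in Z -> v \in Z -> w \notin Z -> tperm u v w = w.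
  by move=> uZ vZ wZ; rewrite tpermD //; apply: contraNneq wZ => <-.
have y1Z : y1 \in Z by rewrite /y1; case: tpermP.
pose p := (tperm x' x * tperm y1 y)%g.
have px' : p x' = x.
  rewrite permM tpermL tpermD //; last exact: mate_neq.
  by rewrite -[x in _ != x](tpermL x') (inj_eq perm_inj) mate_neq.
have py' : p y' = y by rewrite permM -/y1 tpermL.
have pZ u : u \notin Z -> p u = u by move=> uZ; rewrite permM !tZ.
have cp u : c (p u) = c u by rewrite permM ct // ct.
pose D2 := relabel p D'.
have [||q cq Dq] := IHn D2.
- rewrite -ltnS; apply: leq_trans leZ; rewrite ltnS; apply: proper_card.
  apply/properP; split.
    apply/subsetP=> u; rewrite !inE; apply: contraNneq => eq_u.
    have uZ : u \notin Z by rewrite inE negbK eq_u.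
    by rewrite -{2}(pZ u uZ) mate_relabelE -eq_u pZ // ZD.
  by exists x; rewrite // inE negbK -{2}px' mate_relabelE py'.
- move=> a b; rewrite eq_c -(card_imset _ (@perm_inj _ p)).
  apply: eq_card => u; rewrite !inE; apply/imsetP/idP.
    by case=> v; rewrite inE => cv ->; rewrite mate_relabelE !cp.
  move=> cu; exists ((p^-1)%g u); last by rewrite permKV.
  by rewrite inE -cp permKV -(cp (mate D' _)) -mate_relabel.
exists (p * q)%g => [u|]; first by rewrite permM cq cp.
by rewrite relabelM.
Qed.

(** * Horizontal arcs *)

Lemma rows_permP k l (p : {perm node k l}) :
  (forall x, is_upper (p x) = is_upper x) -> exists s t, p = rows_perm s t.
Proof.
move=> pu.
have plow i : {j | p (inl i) = inl j}.
  by have := pu (inl i); case: (p _) => //= j; exists j.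
have pup i : {j | p (inr i) = inr j}.
  by have := pu (inr i); case: (p _) => //= j; exists j.
have sI : injective (fun i => sval (plow i)).
  move=> i i' /(congr1 (@inl 'I_k 'I_l)).
  by rewrite -(svalP (plow i)) -(svalP (plow i')) => /perm_inj[].
have tI : injective (fun i => sval (pup i)).
  move=> i i' /(congr1 (@inr 'I_k 'I_l)).
  by rewrite -(svalP (pup i)) -(svalP (pup i')) => /perm_inj[].
exists (perm sI), (perm tI); apply/permP=> x.
by rewrite rows_permE; case: x => i /=; rewrite permE; [case: (plow i) | case: (pup i)].
Qed.

Section Ends.
Variable r : nat.
Implicit Types (D : diagram r r).

Definition upper_ends D : {set 'I_r} := [set i | is_upper (mate D (inr i))].
Definition lower_ends D : {set 'I_r} := [set i | ~~ is_upper (mate D (inl i))].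

Lemma upper_ends_mate D i :
  reflect (exists j, mate D (inr i) = inr j) (i \in upper_ends D).
Proof.
rewrite inE; case e: (mate D _) => [j|j] /=; last by left; exists j.
by right=> -[].
Qed.

Lemma lower_ends_mate D i :
  reflect (exists j, mate D (inl i) = inl j) (i \in lower_ends D).
Proof.
rewrite inE; case e: (mate D _) => [j|j] /=; first by left; exists j.
by right=> -[].
Qed.

Lemma upper_vertical D i :
  reflect (exists j, mate D (inr i) = inl j) (i \notin upper_ends D).
Proof.
rewrite inE; case e: (mate D _) => [j|j] /=; first by left; exists j.
by right=> -[].
Qed.

Lemma lower_vertical D i :
  reflect (exists j, mate D (inl i) = inr j) (i \notin lower_ends D).
Proof.
rewrite inE; case e: (mate D _) => [j|j] /=; last by left; exists j.
by right=> -[].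
Qed.

Let cnt D a b := #|[set x | (is_upper x == a) && (is_upper (mate D x) == b)]|.

Let cnt_row D a : (cnt D a true + cnt D a false = r)%N.
Proof.
pose A := [set x : node r r | is_upper x == a].
have <- : #|A| = r.
  have rowE (f : 'I_r -> node r r) : injective f ->
      (forall x, (x \in A) = (x \in codom f)) -> #|A| = r.
    by move=> fI eA; rewrite (eq_card eA) card_codom // card_ord.
  have inlI : injective (@inl 'I_r 'I_r) by move=> x y [].
  have inrI : injective (@inr 'I_r 'I_r) by move=> x y [].
  case: a @A rowE => A rowE; [apply: (rowE _ inrI) | apply: (rowE _ inlI)];
  by case=> i; rewrite !inE ?codom_f //=; apply/esym/negbTE/codomP => -[].
rewrite -(cardsID [set x | is_upper (mate D x)] A) /cnt; congr (_ + _)%N.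
  by apply: eq_card => x; rewrite !inE eqb_id.
by apply: eq_card => x; rewrite !inE eqbF_neg andbC.
Qed.

Let cnt_upper D : cnt D true true = #|upper_ends D|.
Proof.
rewrite -(card_imset _ (@inr_inj 'I_r 'I_r)); apply: eq_card => x.
rewrite !inE !eqb_id; apply/andP/imsetP.
  by case: x => i [] // _ ue; exists i; rewrite ?inE.
by case=> i; rewrite inE => ue ->.
Qed.

Let cnt_lower D : cnt D false false = #|lower_ends D|.
Proof.
rewrite -(card_imset _ (@inl_inj 'I_r 'I_r)); apply: eq_card => x.
rewrite !inE !eqbF_neg; apply/andP/imsetP.
  by case: x => i [] // _ ue; exists i; rewrite ?inE.
by case=> i; rewrite inE => ue ->.
Qed.

Let cnt_vert D : cnt D true false = cnt D false true.
Proof.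
rewrite /cnt -(card_imset _ (@mate_inj _ _ D)); apply: eq_card => x.
rewrite !inE; apply/imsetP/andP.
  by case=> y; rewrite inE => /andP[yu ym] ->; rewrite mateK.
case=> xu xm; exists (mate D x); rewrite ?mateK // inE mateK.
by rewrite xm xu.
Qed.

(** Each vertical arc has one end in either row. *)
Lemma card_lower_ends D : #|lower_ends D| = #|upper_ends D|.
Proof.
rewrite -cnt_lower -cnt_upper.
by have := cnt_row D true; have := cnt_row D false; rewrite cnt_vert; lia.
Qed.

Lemma relabel_rows D D' : #|upper_ends D| = #|upper_ends D'| ->
  exists s t, D = relabel (rows_perm s t) D'.
Proof.
move=> eq_ue; have [a b|p pu ->] := @relabel_transitive _ _ _ (@is_upper r r) D D'.
  rewrite -!/(cnt _ a b).
  have := cnt_row D true; have := cnt_row D false.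
  have := cnt_row D' true; have := cnt_row D' false.
  have := cnt_vert D; have := cnt_vert D'.
  have := cnt_upper D; have := cnt_upper D'.
  by case: a; case: b; lia.
by have [s [t ->]] := rows_permP pu; exists s, t.
Qed.

Lemma card_upper_ends_rows D s t :
  #|upper_ends (relabel (rows_perm s t) D)| = #|upper_ends D|.
Proof.
rewrite -[RHS](card_imset _ (@perm_inj _ t)); apply: eq_card => i.
have up x : is_upper (rows_perm s t x) = is_upper x.
  by rewrite rows_permE; case: x.
rewrite -(permKV t i) (mem_imset _ _ (@perm_inj _ t)) !inE.
have -> : inr (t ((t^-1)%g i)) = rows_perm s t (inr ((t^-1)%g i)).
  by rewrite rows_permE.
by rewrite mate_relabelE up.
Qed.

Lemma upper_ends0 D : #|upper_ends D| = 0%N -> exists s, D = perm_diagram s.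
Proof.
move=> ue0; have [|s [t ->]] := @relabel_rows D (id_diagram r).
  rewrite ue0; apply/esym/eqP; rewrite cards_eq0; apply/eqP/setP=> i.
  by rewrite !inE mate_perm.
exists (s^-1 * t)%g; apply: eq_diagram => x.
rewrite -(permKV (rows_perm s t) x) mate_relabelE.
move: (_ x) => {}x; rewrite !mate_perm !rows_permE.
by case: x => i /=; rewrite ?invMg ?invgK ?permM ?permK
  ?invg1 ?perm1.
Qed.

(** Reconnecting two vertical arcs [i]-[a] and [j]-[l] as the horizontal arcs
    [i]-[j] and [a]-[l] is the transposition of the upper [i] and the lower [l]. *)
Lemma upper_ends_tperm D i l j a :
    mate D (inr i) = inl a -> mate D (inl l) = inr j -> i != j ->
  let D' := relabel (tperm (inr i) (inl l)) D in
  [/\ upper_ends D' = i |: (j |: upper_ends D),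
      #|upper_ends D'| = (#|upper_ends D| + 2)%N
    & mate D' (inr i) = inr j].
Proof.
move=> Di Dl ij; set t := tperm _ _ => D'.
have Dj : mate D (inr j) = inl l by rewrite -Dl mateK.
have D'i : mate D' (inr i) = inr j.
  by rewrite mate_relabel tpermV tpermL Dl tpermD.
have ueE : upper_ends D' = i |: (j |: upper_ends D).
  apply/setP=> y; rewrite 3!inE 2!inE.
  have [->|yi] := eqVneq y i; first by rewrite D'i.
  have [->|yj] := eqVneq y j; first by rewrite -D'i mateK.
  rewrite mate_relabel tpermV (tpermD (z := inr y)) //; last by rewrite eq_sym.
  rewrite inE; case Dy: (mate D (inr y)) => [b|b] /=.
    rewrite tpermD //; apply: contra_neq yj => lb.
    by apply: (@inr_inj 'I_r 'I_r); apply: (@mate_inj _ _ D); rewrite Dy Dj lb.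
  rewrite tpermD //; apply/eqP => -[ib].
  by have := mateK D (inr y); rewrite Dy -ib Di.
split=> //; rewrite ueE !cardsU1 !inE (negPf ij) /= Dj Di /=; lia.
Qed.

(** Conversely an upper and a lower horizontal arc can be traded for two
    vertical ones; this is the step of all inductions on the number of
    horizontal arcs. *)
Lemma upper_ends_untperm D i l :
    i \in upper_ends D -> l \in lower_ends D ->
  let D' := relabel (tperm (inr i) (inl l)) D in
  [/\ i \notin upper_ends D', l \notin lower_ends D',
      mate D' (inr i) != inl l & #|upper_ends D| = (#|upper_ends D'| + 2)%N].
Proof.
move=> /upper_ends_mate[j Di] /lower_ends_mate[a Dl] D'.
have ij : j != i by have := mate_neq D (inr i); rewrite Di.
have al : a != l by have := mate_neq D (inl l); rewrite Dl.
have D'i : mate D' (inr i) = inl a.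
  by rewrite mate_relabel tpermV tpermL Dl tpermD // eq_sym.
have D'l : mate D' (inl l) = inr j.
  by rewrite mate_relabel tpermV tpermR Di tpermD // eq_sym.
have [|_ <- _] := upper_ends_tperm D'i D'l; first by rewrite eq_sym.
by rewrite relabel_tpermK !inE D'i D'l; split.
Qed.

Lemma even_upper_ends D : ~~ odd #|upper_ends D|.
Proof.
have [n] := ubnP #|upper_ends D|; elim: n D => // n IHn D ltn.
have [->|[i iD]] := set_0Vmem (upper_ends D); first by rewrite cards0.
have /card_gt0P[l lD] : (0 < #|lower_ends D|)%N.
  by rewrite card_lower_ends; apply/card_gt0P; exists i.
have [_ _ _ e] := upper_ends_untperm iD lD.
by rewrite e oddD addbF IHn //; move: ltn; rewrite e; lia.
Qed.

Definition diagrams_with c := #|[set D : diagram r r | #|upper_ends D| == c]|.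

Lemma card_vertical_pairs D i : i \notin upper_ends D ->
  (#|[set l | (l \notin lower_ends D) && (mate D (inr i) != inl l)]|
     = r - #|upper_ends D| - 1)%N.
Proof.
case/upper_vertical=> a Di.
have aD : a \in ~: lower_ends D by rewrite !inE negbK -Di mateK.
have <- : #|~: lower_ends D :\ a| = (r - #|upper_ends D| - 1)%N.
  have := cardsC (lower_ends D); rewrite (cardsD1 a (~: _)) aD card_ord => e.
  by rewrite -[X in _ = (X - _ - _)%N]e card_lower_ends addKn add1n subn1.
apply: eq_card => l; rewrite !inE Di negbK andbC; congr (_ && _).
by rewrite eq_sym.
Qed.

(** Double counting of the diagrams with a marked upper and a marked lower
    horizontal end, against those with a marked pair of distinct vertical arcs. *)
Lemma diagrams_with_rec c :
  (diagrams_with c.+2 * c.+2 ^ 2 = diagrams_with c * ((r - c) * (r - c - 1)))%N.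
Proof.
pose hor D i l := [&& #|upper_ends D| == c.+2, i \in upper_ends D & l \in lower_ends D].
pose ver D i l := [&& #|upper_ends D| == c, i \notin upper_ends D,
  l \notin lower_ends D & mate D (inr i) != inl l].
have horE D i l : hor (relabel (tperm (inr i) (inl l)) D) i l = ver D i l.
  apply/idP/idP.
    case/and3P=> /eqP ue iD lD.
    have [] := upper_ends_untperm iD lD; rewrite relabel_tpermK ue.
    by rewrite /ver => -> -> -> /eqP; rewrite addn2 !eqSS eq_sym => ->.
  case/and4P=> /eqP ue /upper_vertical[a Di] /lower_vertical[j Dl] il.
  have ij : i != j.
    by apply: contraNneq il => ->; rewrite -Dl mateK.
  have [ueE ce mi] := upper_ends_tperm Di Dl ij.
  rewrite /hor ce ue addn2 eqxx ueE !inE eqxx /=.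
  rewrite mate_relabel tpermV tpermR Di tpermD //.
  by apply: contraNneq il => e; rewrite Di e.
have cardE (P : pred (diagram r r)) :
    #|[set D | P D]| = (\sum_(D : diagram r r) P D)%N.
  by rewrite -sum1dep_card big_mkcond; apply: eq_bigr => D _; case: (P D).
have sumE (A : {set 'I_r}) : (\sum_(l : 'I_r) (l \in A))%N = #|A|.
  by rewrite -sum1_card [RHS]big_mkcond; apply: eq_bigr => l _; case: (l \in A).
transitivity (\sum_(D : diagram r r) \sum_(i : 'I_r) \sum_(l : 'I_r) hor D i l)%N.
  rewrite /diagrams_with cardE big_distrl; apply: eq_bigr => D _ /=.
  rewrite /hor; case: eqP => [ue|_]; last by rewrite mul0n big1 // => i _; rewrite big1.
  rewrite mul1n -[X in (X ^ 2)%N]ue expnS expn1 -{1}sumE -card_lower_ends -sumE big_distrl.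
  by apply: eq_bigr => i _ /=; case: (i \in _); rewrite ?mul1n // mul0n big1.
transitivity (\sum_(D : diagram r r) \sum_(i : 'I_r) \sum_(l : 'I_r) ver D i l)%N.
  rewrite [LHS]exchange_big [RHS]exchange_big; apply: eq_bigr => i _ /=.
  rewrite [LHS]exchange_big [RHS]exchange_big; apply: eq_bigr => l _ /=.
  rewrite (reindex_inj (bij_inj (relabel_bij (tperm (inr i) (inl l))))).
  by apply: eq_bigr => D _; rewrite horE.
rewrite /diagrams_with cardE big_distrl; apply: eq_bigr => D _ /=.
rewrite /ver; case: eqP => [ue|_]; last by rewrite mul0n big1 // => i _; rewrite big1.
have e : #|~: upper_ends D| = (r - c)%N.
  by rewrite -ue cardsCs setCK card_ord.
rewrite mul1n -[X in (X * _)%N]e -sumE big_distrl; apply: eq_bigr => i _ /=.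
rewrite in_setC; case: (boolP (i \in _)) => iD /=; first by rewrite big1.
rewrite mul1n -ue -(card_vertical_pairs iD) -sumE.
by apply: eq_bigr => l _; rewrite [in RHS]inE.
Qed.

Lemma diagrams_with0 : diagrams_with 0 = r`!.
Proof.
have pI : injective (@perm_diagram r).
  move=> s t st; apply/permP=> i.
  by have := mate_perm s (inl i); rewrite st mate_perm /= => -[].
rewrite -(card_Sn r) -(card_imset _ pI); apply: eq_card => D; rewrite inE.
apply/eqP/imsetP => [/upper_ends0[s ->]|[s _ ->]]; first by exists s.
by apply/eqP; rewrite cards_eq0; apply/eqP/setP=> i; rewrite !inE mate_perm.
Qed.

(** The number of diagrams is the quotient of the order of the group of pairs of
    row permutations by that of the stabiliser of one of them: flips and
    permutations of the k horizontal arcs in each row, simultaneous permutations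
    of the vertical ones.  The recursion replaces the study of the stabiliser. *)
Lemma diagrams_withE k : (k.*2 <= r)%N ->
  (diagrams_with k.*2 * ((2 ^ k * k`!) ^ 2 * (r - k.*2)`!) = r`! ^ 2)%N.
Proof.
elim: k => [_|k IHk lekr].
  by rewrite diagrams_with0 subn0 expn0 fact0 muln1 exp1n mul1n mulnn.
rewrite -IHk; last by lia.
have -> : ((r - k.*2)`! = (r - k.*2) * (r - k.*2 - 1) * (r - k.+1.*2)`!)%N.
  have -> : (r - k.*2 = (r - k.+1.*2).+2)%N by lia.
  by rewrite !factS subn1 /= mulnA.
have := diagrams_with_rec k.*2.
rewrite doubleS (factS k) (expnS 2 k).
move: (diagrams_with _) (diagrams_with _) (_ - _)%N (_`!) (k`!) (2 ^ k)%N.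
move=> d1 d0 a f g e rec.
have -> : (2 * e * (k.+1 * g) = k.*2.+2 * (e * g))%N by lia.
rewrite expnMn -mulnA mulnA rec; move: ((e * g) ^ 2)%N => h.
by rewrite -!mulnA; congr (_ * _)%N;
  rewrite [RHS]mulnCA; congr (_ * _)%N; rewrite mulnCA.
Qed.

End Ends.

(** * The element Phi is the sum of all diagrams *)

Lemma rows_permM k l (s s' : 'S_k) (t t' : 'S_l) :
  (rows_perm s t * rows_perm s' t')%g = rows_perm (s * s') (t * t').
Proof.
by apply/permP=> x; rewrite permM !rows_permE; case: x => i /=; rewrite permM.
Qed.

Section Multiplicity.
Variables (K : fieldType) (delta : K) (r : nat).
Local Notation "x ** y" := (@bcomp K delta r r r x y) (at level 40).

Lemma sym_sandwich (E : diagram r r) :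
  sym_sum K r ** diag K E ** sym_sum K r
    = \sum_(s : 'S_r) \sum_(t : 'S_r) diag K (relabel (rows_perm s t) E).
Proof.
have -> : sym_sum K r ** diag K E = \sum_t diag K (relabel (rows_perm 1 t) E).
  rewrite /sym_sum bcomp_suml; apply: eq_bigr => t _.
  exact: bcomp_composes (composes_perm_l t E).
rewrite /sym_sum bcomp_sumr (reindex_inj invg_inj); apply: eq_bigr => s _.
rewrite bcomp_suml; apply: eq_bigr => t _.
rewrite (bcomp_composes _ (composes_perm_r _ _)).
by rewrite -relabelM rows_permM mul1g mulg1 invgK.
Qed.

Definition multiplicity (E D : diagram r r) : nat :=
  \sum_(s : 'S_r) \sum_(t : 'S_r) (D == relabel (rows_perm s t) E).

Lemma multiplicity_rows E D a b :
  multiplicity E (relabel (rows_perm a b) D) = multiplicity E D.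
Proof.
rewrite /multiplicity (reindex_inj (mulIg a)); apply: eq_bigr => s _.
rewrite (reindex_inj (mulIg b)); apply: eq_bigr => t _.
by rewrite -rows_permM relabelM (inj_eq (bij_inj (relabel_bij _))).
Qed.

(** The row permutations act transitively on the diagrams with a given number of
    horizontal arcs, so all of them occur equally often. *)
Lemma multiplicityE E D :
  (multiplicity E D * diagrams_with r #|upper_ends E|
     = (#|upper_ends D| == #|upper_ends E|) * r`! ^ 2)%N.
Proof.
have total : (\sum_D' multiplicity E D' = r`! ^ 2)%N.
  rewrite exchange_big -mulnn -{1}(card_Sn r) -sum1_card big_distrl /=.
  apply: eq_big => [s|s _]; first by rewrite inE.
  rewrite mul1n exchange_big -(card_Sn r) -sum1_card /=.
  apply: eq_big => [t|t _]; first by rewrite inE.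
  by rewrite (bigD1 (relabel (rows_perm s t) E)) //= eqxx big1 // => D' /negPf ->.
have zero D' : #|upper_ends D'| != #|upper_ends E| -> multiplicity E D' = 0%N.
  move=> ne; rewrite /multiplicity big1 // => s _; rewrite big1 // => t _.
  by case: (D' =P _) => // e; rewrite e card_upper_ends_rows eqxx in ne.
case: eqP => [eqD|/eqP/zero ->]; last by rewrite !mul0n.
rewrite mul1n -total (bigID (fun D' => #|upper_ends D'| == #|upper_ends E|)) /=.
rewrite [X in (_ + X)%N]big1 ?addn0 // /diagrams_with.
rewrite -sum1dep_card big_distrr /=; apply: eq_bigr => D' /eqP eqD'.
rewrite muln1; have [|a [b ->]] := @relabel_rows _ D' D; first by rewrite eqD'.
by rewrite multiplicity_rows.
Qed.

Lemma bcoef_sandwich E D :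
  bcoef (sym_sum K r ** diag K E ** sym_sum K r) D = (multiplicity E D)%:R.
Proof.
rewrite sym_sandwich bcoef_sum natr_sum; apply: eq_bigr => s _.
by rewrite bcoef_sum natr_sum; apply: eq_bigr => t _; rewrite bcoef_diag.
Qed.

Lemma multiplicity_ends k E D : #|upper_ends E| = k.*2 ->
  multiplicity E D
    = ((#|upper_ends D| == k.*2) * ((2 ^ k * k`!) ^ 2 * (r - k.*2)`!))%N.
Proof.
move=> ueE; have ler : (k.*2 <= r)%N by rewrite -ueE -[X in (_ <= X)%N]card_ord max_card.
have d0 : (0 < diagrams_with r k.*2)%N.
  by apply/card_gt0P; exists E; rewrite inE ueE.
apply/eqP; rewrite -(eqn_pmul2r d0) -{1}ueE multiplicityE ueE.
apply/eqP; rewrite -(diagrams_withE ler) -[RHS]mulnA.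
by rewrite [in RHS](mulnC _ (diagrams_with _ _)).
Qed.

End Multiplicity.

Lemma cast_e_diagram (K : fieldType) i m r (e : (i + 2 + m)%N = r) (a b : 'I_r) :
    a = i :> nat -> b = i.+1 :> nat ->
  cast_brauer e (diag K (e_diagram i m)) = diag K (hook a b).
Proof.
case: r / e a b => a b ai bi; rewrite /cast_brauer /=; congr diag.
have ab : a != b by apply/eqP => ab; move: bi; rewrite -ab ai; lia.
pose L q : 'I_(i + 2 + m) := lshift m (lshift 2 q).
have vertL q : mate (hook a b) (inl (L q)) = inr (L q).
  by rewrite mate_hook_vert //; apply/eqP => /(congr1 val) /=; rewrite ?ai ?bi;
     have := ltn_ord q; lia.
pose R q : 'I_(i + 2 + m) := rshift (i + 2) q.
have vertR q : mate (hook a b) (inl (R q)) = inr (R q).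
  by rewrite mate_hook_vert //; apply/eqP => /(congr1 val) /=; rewrite ?ai ?bi; lia.
have aE : a = lshift m (rshift i ord0) by apply: val_inj; rewrite /= ai addn0.
have bE : b = lshift m (rshift i ord_max) by apply: val_inj; rewrite /= bi addn1.
have ord2 (q : 'I_2) : q = ord0 \/ q = ord_max.
  by case: q => [[|[|//]] ?]; [left|right]; apply: val_inj.
have ne : (ord0 : 'I_2) != ord_max by [].
have mid x : mate (hook a b) (left_node m m (right_node i i x))
    = left_node m m (right_node i i (mate (hook ord0 ord_max) x)).
  case: x => q; case: (ord2 q) => -> /=; rewrite -?aE -?bE.
  - by rewrite !mate_hook_lower //= -bE.
  - rewrite -{1}(mate_hook_lower ab) mateK.
    by rewrite -{1}(mate_hook_lower ne) mateK /= -aE.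
  - by rewrite !mate_hook_upper //= -bE.
  - rewrite -{1}(mate_hook_upper ab) mateK.
    by rewrite -{1}(mate_hook_upper ne) mateK /= -aE.
apply: eq_diagram => x; rewrite /e_diagram (proj1 composes_UA).
case: (node_splitP x) => -[y ->].
  rewrite mate_tens_left; case: (node_splitP y) => -[z ->].
    rewrite mate_tens_left mate_perm; case: z => q /=; rewrite ?invg1 perm1.
      by rewrite vertL.
    by rewrite -[RHS]/(mate _ (inr (L q))) -vertL mateK.
  by rewrite mate_tens_right mid.
rewrite mate_tens_right mate_perm; case: y => q /=; rewrite ?invg1 perm1.
  by rewrite vertR.
by rewrite -[RHS]/(mate _ (inr (R q))) -vertR mateK.
Qed.

Lemma e_genE (K : fieldType) r (a b : 'I_r) : b = a.+1 :> nat ->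
  e_gen K r a.+1 = diag K (hook a b).
Proof.
move=> ba; rewrite /e_gen; case: eqP => [e|[]].
  exact: cast_e_diagram.
by have := ltn_ord b; rewrite ba /=; lia.
Qed.

Section PhiSum.
Variables (K : fieldType) (n : nat).
Local Notation mul := (@bcomp K (brauer_parameter K n) n.+1 n.+1 n.+1).

(** Reading the product from its innermost factor, each hook meets two upper
    nodes to the right of all the horizontal ends so far.  The strands arriving
    there are vertical, so one more pair of horizontal arcs appears and no loop
    is closed. *)
Lemma E_eltE k : (k.*2 <= n.+1)%N ->
  exists2 E, E_elt K n k = diag K E & #|upper_ends E| = k.*2.
Proof.
move=> lekn; pose f j := e_gen K n.+1 (n + 2 - 2 * j).
suff tail c : (c <= k)%N -> exists E,
    [/\ \big[mul / diag K (id_diagram n.+1)]_(k.+1 - c <= j < k.+1) f j = diag K E,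
        #|upper_ends E| = c.*2
      & forall i, i \in upper_ends E -> (i + (k.+1 - c).*2 <= n.+2)%N].
  have [E [EE ce _]] := tail k (leqnn k); exists E => //.
  by rewrite /E_elt -EE; congr (\big[_/_]_(_ <= _ < _) _); lia.
elim: c => [_|c IHc ltck].
  exists (id_diagram n.+1); rewrite subn0 big_geq //.
  have ue0 : upper_ends (id_diagram n.+1) = set0.
    by apply/setP=> i; rewrite !inE mate_perm.
  by rewrite ue0 cards0; split=> // i; rewrite inE.
have [E [EE ce bd]] := IHc (ltnW ltck).
set m := (k.+1 - c.+1)%N; have em : (k.+1 - c = m.+1)%N by rewrite /m; lia.
have m0 : (0 < m)%N by rewrite /m; lia.
have mk : (m <= k)%N by rewrite /m; lia.
rewrite em in EE bd.
have ltj : (n.+1 - m.*2 < n.+1)%N by lia.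
have lti : (n.+2 - m.*2 < n.+1)%N by lia.
pose a := Ordinal ltj; pose b := Ordinal lti.
have ba : b = a.+1 :> nat by rewrite /=; lia.
have ab : a != b by apply/eqP => e; move: ba; rewrite -e /=; lia.
have /upper_vertical[a' Ea] : a \notin upper_ends E.
  by apply/negP=> /bd /=; lia.
have bE : b \notin upper_ends E by apply/negP=> /bd /=; lia.
have /upper_vertical[l Eb] := bE.
have El : mate E (inl l) = inr b by rewrite -Eb mateK.
have [ueE cE mE] := upper_ends_tperm Ea El ab.
pose E' := relabel (tperm (inr a) (inl l)) E.
exists E'; split.
- rewrite big_ltn; last by rewrite ltnS.
  rewrite EE; have -> : f m = diag K (hook a b).
    by rewrite /f -(e_genE K ba) /=; congr e_gen; lia.
  apply: bcomp_composes; rewrite -[E](relabel_tpermK (inr a) (inl l)).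
  exact: composes_hook_l.
- by rewrite cE ce doubleS addn2.
- move=> i; rewrite ueE !inE => /or3P[/eqP->|/eqP->|ie] /=; [lia|lia|].
  have : i \in upper_ends E by rewrite inE.
  by move/bd; lia.
Qed.

Lemma Phi_eltE : [pchar K] =i pred0 ->
  Phi_elt K n = \sum_(D : diagram n.+1 n.+1) diag K D.
Proof.
move=> /pcharf0P char0; apply: bcoef_inj => D.
have -> : bcoef (\sum_D' diag K D') D = 1.
  have /= e := sum_diag_bcoef predT (fun=> 1 : K) D; rewrite -[RHS]e.
  by congr bcoef; apply: eq_bigr => D' _; rewrite scale1r.
rewrite /Phi_elt bcoef_sum big_mkord.
pose h := #|upper_ends D|./2.
have ueD : #|upper_ends D| = h.*2.
  by rewrite -[LHS]odd_double_half (negPf (even_upper_ends D)).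
have leh : (h.*2 <= n.+1)%N by rewrite -ueD -[X in (_ <= X)%N]card_ord max_card.
have hN : (h < ((n + 1) %/ 2).+1)%N.
  by rewrite divn2; lia.
have term k : (k.*2 <= n.+1)%N -> bcoef (Phi_coef K n k *: Xi_elt K n k) D = (k == h)%:R.
  move=> lek; have [E EE ceE] := E_eltE lek.
  rewrite bcoefZ /Xi_elt EE bcoef_sandwich (multiplicity_ends D ceE) /Phi_coef.
  rewrite ueD (inj_eq double_inj) eq_sym; case: (k == h); last by rewrite mul0n mulr0.
  rewrite mul1n addn1 mul2n mulVf // char0 muln_eq0 negb_or expn_eq0 andbT.
  by rewrite muln_eq0 expn_eq0 /= -!lt0n !fact_gt0.
rewrite (bigD1 (Ordinal hN)) //= term // eqxx big1 ?addr0 // => k neq.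
rewrite term; last by have := ltn_ord k; lia.
by case: (_ =P h) => // kh; case/eqP: neq; apply: val_inj.
Qed.

End PhiSum.

(** * Sums of diagrams with a prescribed part *)

Section LocalSum.
Variables (K : fieldType) (k l : nat).
Implicit Types (D : diagram k l) (S : {set node k l}).

Definition agree_off S D : {set diagram k l} :=
  [set D' | [forall x, (x \in S) || (mate D' x == mate D x)]].

(** The multilinear form of this element is, up to sign, the Pfaffian of the
    pairings between the arguments at [S] times the pairings along the other
    arcs of [D]. *)
Definition local_sum D S : brauer K k l :=
  \sum_(D' in agree_off S D) diag K D'.

Definition mate_stable D S := forall x, x \in S -> mate D x \in S.

Lemma agree_offP S D D' :
  reflect (forall x, x \notin S -> mate D' x = mate D x) (D' \in agree_off S D).
Proof.
rewrite inE; apply: (iffP forallP) => agr x; last first.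
  by case: (boolP (x \in S)) => //= /agr ->.
by move=> xS; have := agr x; rewrite (negPf xS) => /eqP.
Qed.

Lemma mate_stableC D S x : mate_stable D S -> (mate D x \in S) = (x \in S).
Proof. by move=> st; apply/idP/idP=> /st; rewrite ?mateK. Qed.

Lemma agree_off_relabel (p : {perm node k l}) S D D' :
  (relabel p D' \in agree_off (p @: S) (relabel p D)) = (D' \in agree_off S D).
Proof.
apply/agree_offP/agree_offP => agr x xS.
  apply: (@perm_inj _ p); rewrite -!mate_relabelE agr //.
  by rewrite mem_imset //; apply: perm_inj.
rewrite -(permKV p x) !mate_relabelE agr //.
by rewrite -(mem_imset _ _ (@perm_inj _ p)) permKV.
Qed.

Lemma local_sum_relabel (p : {perm node k l}) D S :
  local_sum (relabel p D) (p @: S)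
    = \sum_(D' in agree_off S D) diag K (relabel p D').
Proof.
rewrite /local_sum (reindex_inj (bij_inj (relabel_bij p))).
by apply: eq_bigl => D'; rewrite agree_off_relabel.
Qed.

Lemma mate_stable_relabel (p : {perm node k l}) D S :
  mate_stable D S -> mate_stable (relabel p D) (p @: S).
Proof.
move=> st _ /imsetP[x xS ->]; rewrite mate_relabelE mem_imset ?st //.
exact: perm_inj.
Qed.

End LocalSum.

Definition band r (A : {set 'I_r}) : {set node r r} :=
  [set x | match x with inl i => i \in A | inr i => i \in A end].

(** A diagram agreeing with the identity on the last strands is a diagram on the
    first ones beside an identity. *)
Lemma extend_all (K : fieldType) s m r (e : (s + m)%N = r) :
  cast_brauer e (btens (\sum_(D : diagram s s) diag K D) (diag K (id_diagram m)))
    = local_sum K (id_diagram r) (band [set i : 'I_r | (i < s)%N]).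
Proof.
case: r / e; rewrite /cast_brauer /= btens_suml.
under eq_bigr do rewrite btens_diag.
set S := band _; pose f (D : diagram s s) := tens_diagram D (id_diagram m).
have rightS (x : node m m) : right_node s s x \notin S.
  by case: x => i; rewrite inE /= inE /= -leqNgt leq_addr.
have leftS (x : node s s) : left_node m m x \in S.
  by case: x => i; rewrite inE /= inE /= ltn_ord.
have mate_right (x : node m m) :
    mate (id_diagram (s + m)) (right_node s s x)
      = right_node s s (mate (id_diagram m) x).
  by rewrite !mate_perm; case: x => i /=; rewrite ?invg1 !perm1.
have f_inj : injective f.
  move=> D D' eqf; apply: eq_diagram => x; apply: (@left_node_inj _ _ m m).
  by rewrite -(mate_tens_left D (id_diagram m)) -/(f D) eqf mate_tens_left.
rewrite /local_sum; have -> : agree_off S (id_diagram (s + m)) = f @: setT.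
  apply/setP=> D'; apply/agree_offP/imsetP=> [agr|[D _ ->] x xS]; last first.
    case: (node_splitP x) xS => -[y ->]; first by rewrite leftS.
    by move=> _; rewrite mate_tens_right mate_right.
  have left x : {y | mate D' (left_node m m x) == left_node m m y}.
    apply: sigW; case: (node_splitP (mate D' (left_node m m x))) => -[y e].
      by exists y; rewrite e.
    have := mateK D' (left_node m m x); rewrite e agr // mate_right => /esym/eqP.
    by rewrite (negPf (left_right_node _ _)).
  pose g x := sval (left x).
  have gE x : mate D' (left_node m m x) = left_node m m (g x).
    exact/eqP/(svalP (left x)).
  have gK : involutive g.
    by move=> x; apply: (@left_node_inj _ _ m m); rewrite -!gE mateK.
  have gx x : g x != x.
    by rewrite -(inj_eq (@left_node_inj _ _ m m)) -gE mate_neq.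
  exists (Diagram (involution_pairing gK gx)); rewrite ?inE //.
  apply: eq_diagram => x; case: (node_splitP x) => -[y ->].
    by rewrite mate_tens_left gE mate_involution.
  by rewrite mate_tens_right agr.
rewrite big_imset /=; last by move=> D D' _ _; apply: f_inj.
by apply: eq_bigl => D; rewrite inE.
Qed.

Section IdealMembership.
Variables (K : fieldType) (delta : K) (n r : nat) (le_nr : (n.+1 <= r)%N).
Variable J : brauer K r r -> Prop.
Hypothesis idealJ : two_sided_ideal delta J.
Hypothesis JPhi : J (extend le_nr (\sum_D diag K D)).
Local Notation "x ** y" := (@bcomp K delta r r r x y) (at level 40).
Local Notation LS := (@local_sum K r r).

Lemma local_sum_perm_l (s : 'S_r) D S :
  diag K (perm_diagram s) ** LS D S
    = LS (relabel (rows_perm 1 s) D) (rows_perm 1 s @: S).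
Proof.
rewrite local_sum_relabel bcomp_sumr; apply: eq_bigr => D' _.
exact: bcomp_composes (composes_perm_l s D').
Qed.

Lemma local_sum_perm_r (s : 'S_r) D S :
  LS D S ** diag K (perm_diagram s)
    = LS (relabel (rows_perm s^-1 1) D) (rows_perm s^-1 1 @: S).
Proof.
rewrite local_sum_relabel bcomp_suml; apply: eq_bigr => D' _.
exact: bcomp_composes (composes_perm_r s D').
Qed.

(** Conjugation by a permutation of the strands moves [A] onto the first n + 1
    strands, where the sum is the generator itself; one transposition brings one
    more element of [A] into place. *)
Lemma local_sum_band (A : {set 'I_r}) :
  #|A| = n.+1 -> J (LS (id_diagram r) (band A)).
Proof.
pose B := [set i : 'I_r | (i < n.+1)%N].
have cB : #|B| = n.+1.
  have wI : injective (widen_ord le_nr) by move=> x y /(congr1 val) /= /val_inj.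
  rewrite -[RHS]card_ord -(card_imset _ wI).
  apply: eq_card => i; rewrite inE; apply/idP/imsetP => [lt|[j _ ->]];
    last exact: (ltn_ord j).
  by exists (Ordinal lt) => //; apply: val_inj.
have [c] := ubnP #|B :\: A|; elim: c A => // c IHc A ltc cA.
have [BA|[f fBA]] := set_0Vmem (B :\: A).
  have -> : A = B.
    apply/esym/eqP; rewrite eqEcard cA cB leqnn andbT.
    by rewrite -setD_eq0 BA.
  by rewrite -(extend_all K (subnKC le_nr)).
have /card_gt0P[a aAB] : (0 < #|A :\: B|)%N.
  by rewrite cardsD setIC cA -cB -cardsD; apply/card_gt0P; exists f.
move: fBA aAB; rewrite !inE => /andP[fA fB] /andP[aB aA].
pose t := tperm a f; pose A' := t @: A.
have tA i : (i \in A') = (t i \in A).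
  by rewrite -[i in LHS](tpermK a f) -/t mem_imset //; apply: perm_inj.
have tA' : J (LS (id_diagram r) (band A')).
  apply: IHc; last by rewrite card_imset //; apply: perm_inj.
  rewrite -ltnS; apply: leq_trans ltc; rewrite ltnS; apply: proper_card.
  apply/properP; split.
    apply/subsetP=> i; rewrite !inE tA => /andP[iA iB]; rewrite iB andbT.
    apply: contra iA => iA; rewrite /t tpermD //.
      by apply: contraNneq aB => ->.
    by apply: contraNneq fA => ->.
  by exists f; rewrite !inE ?fA ?fB // tA /t tpermR aA.
suff <- : diag K (perm_diagram t) ** LS (id_diagram r) (band A')
          ** diag K (perm_diagram t) = LS (id_diagram r) (band A).
  by apply: (Defs.idealMr idealJ); apply: (Defs.idealMl idealJ).
rewrite local_sum_perm_l local_sum_perm_r -relabelM -imset_comp.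
have tV : (t^-1 = t)%g by apply: tpermV.
rewrite rows_permM tV mulg1 mul1g; congr (LS _ _).
  apply: eq_diagram => x; rewrite -(permKV (rows_perm t t) x) mate_relabelE.
  by move: (_ x) => {}x; rewrite !mate_perm !rows_permE; case: x => i /=; rewrite ?invg1 !perm1.
apply/setP=> x; apply/imsetP/idP.
  case=> y; rewrite inE => yA -> /=; rewrite !rows_permE inE.
  by case: y yA => i /=; rewrite perm1 -tA.
move=> xA; exists (rows_perm t t x).
  by move: xA; rewrite rows_permE !inE; case: x => i /=; rewrite tA /t tpermK.
by rewrite /= !rows_permE; case: x {xA} => i /=; rewrite !perm1 /t tpermK.
Qed.

(** Trading a pair of horizontal arcs for two vertical ones either does not
    affect the sum, or is undone by multiplication with a hook on the side whose
    horizontal arc belongs to the prescribed part.  Without horizontal arcs, the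
    row permutations bring the prescribed part to the last strands. *)
Lemma local_sum_ideal D S :
  mate_stable D S -> #|S| = (2 * n.+1)%N -> J (LS D S).
Proof.
have [c] := ubnP #|upper_ends D|; elim: c D S => // c IHc D S ltc stS cS.
have [ue0|[i iD]] := set_0Vmem (upper_ends D).
  have [|s Ds] := @upper_ends0 _ D; first by rewrite ue0 cards0.
  pose A := [set a : 'I_r | inl a \in S].
  have Srow (a : 'I_r) : (inr (s a) \in S) = (a \in A).
    by rewrite inE -(mate_stableC (inl a) stS) Ds mate_perm.
  have DE : D = relabel (rows_perm 1 s) (id_diagram r).
    apply: eq_diagram => x; rewrite -(permKV (rows_perm 1 s) x) mate_relabelE.
    move: (_ x) => {}x; rewrite Ds !mate_perm !rows_permE.
    by case: x => a /=; rewrite ?invg1 !perm1 // permK.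
  have SE : S = rows_perm 1 s @: band A.
    apply/setP=> x; rewrite -(permKV (rows_perm 1 s) x) (mem_imset _ _ (@perm_inj _ _)).
    move: (_ x) => {}x; rewrite rows_permE [RHS]inE.
    by case: x => a /=; rewrite ?perm1 ?Srow // inE.
  rewrite DE SE -local_sum_perm_l; apply: (Defs.idealMl idealJ).
  apply: local_sum_band; move: cS; rewrite SE card_imset; last exact: perm_inj.
  have -> : band A = (@inl 'I_r 'I_r @: A) :|: (@inr 'I_r 'I_r @: A).
    apply/setP=> x; rewrite inE in_setU; apply/idP/orP.
      by case: x => a aA; [left|right]; apply: imset_f.
    by case=> /imsetP[a aA ->].
  rewrite cardsU (_ : _ :&: _ = set0); last first.
    by apply/setP=> x; rewrite !inE; apply/andP=> -[/imsetP[a _ ->] /imsetP[]].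
  rewrite cards0 subn0 !card_imset; [|exact: inr_inj|exact: inl_inj].
  by rewrite addnn -mul2n => /eqP; rewrite eqn_pmul2l // => /eqP.
have /card_gt0P[l lD] : (0 < #|lower_ends D|)%N.
  by rewrite card_lower_ends; apply/card_gt0P; exists i.
have [_ _ _ ce] := upper_ends_untperm iD lD.
pose p := tperm (inr i) (inl l) : {perm node r r}.
have IH : J (LS (relabel p D) (p @: S)).
  apply: IHc; [by move: ltc; rewrite ce -/p; lia|exact: mate_stable_relabel|].
  by rewrite card_imset //; apply: perm_inj.
have /upper_ends_mate[j Di] := iD; have /lower_ends_mate[a Dl] := lD.
have ij : i != j by have := mate_neq D (inr i); rewrite Di eq_sym.
have la : l != a by have := mate_neq D (inl l); rewrite Dl eq_sym.
(* The upper arc of [i] is prescribed: all summands factor through the hook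
   below that arc. *)
have [iS|iS] := boolP (inr i \in S); last first.
  suff -> : LS D S = diag K (hook i j) ** LS (relabel p D) (p @: S).
    by apply: (Defs.idealMl idealJ).
  rewrite local_sum_relabel bcomp_sumr; apply: eq_bigr => D' /agree_offP agr.
  apply/esym/bcomp_composes; apply: composes_hook_l => //.
  by rewrite agr.
(* The lower arc of [l] is prescribed. *)
have [lS|lS] := boolP (inl l \in S); last first.
  suff -> : LS D S = LS (relabel p D) (p @: S) ** diag K (hook l a).
    by apply: (Defs.idealMr idealJ).
  rewrite local_sum_relabel bcomp_suml; apply: eq_bigr => D' /agree_offP agr.
  apply/esym/bcomp_composes; rewrite /p tpermC; apply: composes_hook_r => //.
  by rewrite agr.
(* Neither is prescribed, so that exchanging [i] and [l] permutes the
   rematchings. *)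
suff <- : LS (relabel p D) (p @: S) = LS D S by [].
have pS x : x \notin S -> p x = x.
  by move=> xS; rewrite tpermD //; apply: contraNneq xS => <-.
have pSE : p @: S = S.
  apply/eqP; rewrite eqEcard card_imset ?leqnn ?andbT; last exact: perm_inj.
  by apply/subsetP=> _ /imsetP[x xS ->]; rewrite /p; case: tpermP.
rewrite pSE /local_sum; apply: eq_bigl => D'.
have agr x : x \notin S -> mate (relabel p D) x = mate D x.
  move=> xS; rewrite -{1}(pS x xS) mate_relabelE pS //.
  by rewrite mate_stableC.
by apply/agree_offP/agree_offP => h x xS; rewrite h // agr.
Qed.

End IdealMembership.

(** * Two extremal properties of matchings on a line *)

Lemma finite_value_ind (T : finType) (f : T -> int) (P : T -> Prop) :
  (forall x, (forall y, f y < f x -> P y) -> P x) -> forall x, P x.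
Proof.
move=> Pf x; have [c] := ubnP #|[set y | f y < f x]|; elim: c x => // c IHc x ltc.
apply: Pf => y fyx; apply: IHc; rewrite -ltnS; apply: leq_trans ltc; rewrite ltnS.
apply: proper_card; apply/properP; split.
  by apply/subsetP=> z; rewrite !inE => /lt_trans; apply.
by exists y; rewrite !inE ?ltxx.
Qed.

Section Line.
Variables (k l : nat) (rank : node k l -> nat).
Hypothesis rank_inj : injective rank.
Implicit Types (D : diagram k l) (x y : node k l) (Q : {set node k l}).

(** Twice the sum over the arcs of the product of the positions of their ends,
    that is a constant minus the sum of the squared lengths of the arcs. *)
Definition tightness D : int := \sum_x (rank x)%:Z * (rank (mate D x))%:Z.

(** Exchanging [x] and [y] replaces the products x x' + y y' by x y' + y x', where
    a prime stands for the mate; each arc is counted twice. *)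
Lemma tightness_tperm D x y : mate D x != y ->
  tightness (relabel (tperm x y) D) = tightness D
    + 2 * ((rank y)%:Z - (rank x)%:Z)
        * ((rank (mate D x))%:Z - (rank (mate D y))%:Z).
Proof.
have [->|xy Dxy] := eqVneq x y.
  by rewrite tperm1 relabel1 !subrr mulr0 addr0.
set t := tperm x y.
(* The exchange adds d e(u) to the position of every node u. *)
pose e u : int := (u == x)%:R - (u == y)%:R.
pose d : int := (rank y)%:Z - (rank x)%:Z.
have rt u : (rank (t u))%:Z = (rank u)%:Z + d * e u.
  rewrite /e /t /d; case: tpermP => [->|->|/eqP/negPf -> /eqP/negPf ->].
  - by rewrite eqxx (negPf xy) /=; ring.
  - by rewrite eqxx [y == x]eq_sym (negPf xy) /=; ring.
  - by rewrite /=; ring.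
have sumE (g : node k l -> int) : \sum_u e u * g u = g x - g y.
  under eq_bigr do rewrite mulrBl.
  rewrite sumrB; congr (_ - _).
    rewrite (bigD1 x) //= eqxx mul1r big1 ?addr0 // => u /negPf ->.
    by rewrite mul0r.
  rewrite (bigD1 y) //= eqxx mul1r big1 ?addr0 // => u /negPf ->.
  by rewrite mul0r.
rewrite /tightness (reindex_inj (@perm_inj _ t)) /=.
under eq_bigr do rewrite mate_relabelE !rt.
transitivity (\sum_u ((rank u)%:Z * (rank (mate D u))%:Z
   + d * (e u * (rank (mate D u))%:Z) + d * (e (mate D u) * (rank u)%:Z)
   + d ^+ 2 * (e u * e (mate D u)))).
  by apply: eq_bigr => u _; ring.
have swap : \sum_u e (mate D u) * (rank u)%:Z = \sum_u e u * (rank (mate D u))%:Z.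
  rewrite (reindex_inj (@mate_inj _ _ D)) /=.
  by apply: eq_bigr => u _; rewrite mateK.
rewrite !big_split /= -!mulr_sumr swap !sumE.
have -> : e (mate D x) - e (mate D y) = 0.
  rewrite /e (negPf (mate_neq D x)) (negPf (mate_neq D y)) (negPf Dxy).
  by rewrite (inv_eq (@mateK _ _ D)) eq_sym (negPf Dxy).
by rewrite /d; ring.
Qed.

(** By minimality of [x], a node on its left has the same mate in [D] and [D'];
    the node that [D'] joins to the mate of [x] in [D], and the one that [D] joins
    to the mate of [x] in [D'], cannot be such nodes. *)
Lemma first_disagreement D D' Q :
    {in Q, forall x, mate D' (mate D x) \in Q} ->
    {in Q, forall x, mate D (mate D' x) \in Q} ->
    (exists2 x, x \in Q & mate D' x != mate D x) ->
  exists x, [/\ x \in Q, (rank x < rank (mate D' (mate D x)))%N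
    & (rank x < rank (mate D (mate D' x)))%N].
Proof.
move=> Q1 Q2 [x0 x0Q ne0].
have Px0 : (x0 \in Q) && (mate D' x0 != mate D x0) by rewrite x0Q.
have [x /andP[xQ ne] minx] :=
  @arg_minnP _ x0 (fun x => (x \in Q) && (mate D' x != mate D x)) rank Px0.
have agree u : u \in Q -> (rank u < rank x)%N -> mate D' u = mate D u.
  move=> uQ ltu; apply: contraTeq ltu => neu.
  by rewrite -leqNgt minx ?uQ.
exists x; split=> //.
  rewrite ltnNge; apply: contra ne; rewrite leq_eqVlt => /orP[/eqP/rank_inj e|lt].
    by rewrite (inv_eq (@mateK _ _ D')) e.
  have := agree _ (Q1 _ xQ) lt; rewrite mateK => /mate_inj e.
  by rewrite (inv_eq (@mateK _ _ D')) -e.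
rewrite ltnNge; apply: contra ne; rewrite leq_eqVlt => /orP[/eqP/rank_inj e|lt].
  by rewrite eq_sym (inv_eq (@mateK _ _ D)) e.
have := agree _ (Q2 _ xQ) lt; rewrite mateK => /mate_inj e.
by rewrite eq_sym (inv_eq (@mateK _ _ D)) e.
Qed.

Definition opener D x := (rank x < rank (mate D x))%N.

Lemma opener_mate D x : opener D (mate D x) = ~~ opener D x.
Proof.
rewrite /opener mateK -leqNgt ltn_neqAle andb_idl // => _.
by apply: contra_neq (mate_neq D x) => /rank_inj.
Qed.

(** A chain of nested arcs is encoded by the set of its left ends. *)
Definition nested D Q :=
  [forall x in Q, opener D x]
  && [forall x in Q, forall y in Q,
       (rank x < rank y)%N ==> (rank (mate D y) < rank (mate D x))%N].

Lemma nestedP D Q :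
  reflect ({in Q, forall x, opener D x} /\
           {in Q &, forall x y, (rank x < rank y)%N ->
                                (rank (mate D y) < rank (mate D x))%N})
          (nested D Q).
Proof.
apply: (iffP andP) => [[/forall_inP op /forall_inP ne]|[op ne]]; split=> //.
- by move=> x y xQ yQ; move/forall_inP/(_ _ yQ)/implyP: (ne x xQ); apply.
- exact/forall_inP.
- by apply/forall_inP=> x xQ; apply/forall_inP=> y yQ; apply/implyP; apply: ne.
Qed.

Definition arc_ends D Q := Q :|: (mate D @: Q).

Lemma arc_ends_stable D Q : mate_stable D (arc_ends D Q).
Proof.
move=> x /setUP[xQ|/imsetP[y yQ ->]]; apply/setUP.
  by right; apply: imset_f.
by left; rewrite mateK.
Qed.

Lemma card_arc_ends D Q : nested D Q -> #|arc_ends D Q| = (2 * #|Q|)%N.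
Proof.
case/nestedP=> op _; rewrite cardsU card_imset; last exact: mate_inj.
rewrite (_ : Q :&: _ = set0) ?cards0 ?subn0 ?mul2n ?addnn //.
apply/setP=> x; rewrite !inE; apply/andP=> -[xQ /imsetP[y yQ xy]].
by have := op x xQ; rewrite xy opener_mate op.
Qed.

(** This is the rearrangement inequality for an order-reversing mate: the
    tightness of any other matching of the same ends decreases when the first
    wrongly matched node gets its mate in [D]. *)
Lemma nested_minimal D Q D' :
    nested D Q -> D' \in agree_off (arc_ends D Q) D ->
  D' = D \/ tightness D < tightness D'.
Proof.
move=> nQ; have /nestedP[op ne] := nQ; set S := arc_ends D Q.
(* On the ends of nested arcs, taking the mate reverses the order. *)
have decr : {in S &, forall x y, (rank x < rank y)%N ->
    (rank (mate D y) < rank (mate D x))%N}.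
  have ltQ x y : x \in Q -> y \in Q -> (rank x < rank (mate D y))%N.
    move=> xQ yQ; have := op x xQ; have := op y yQ; rewrite /opener.
    have [xy|yx|/rank_inj->//] := ltngtP (rank x) (rank y); first by lia.
    by have := ne _ _ yQ xQ yx; lia.
  move=> x y /setUP[xQ|/imsetP[x' xQ ->]] /setUP[yQ|/imsetP[y' yQ ->]];
    rewrite ?mateK.
  - exact: ne.
  - by move=> _; apply: ltQ.
  - by have := ltQ _ _ yQ xQ; lia.
  - move=> lt; have := ne _ _ xQ yQ; have := op _ xQ; have := op _ yQ.
    by have [//|xy|/rank_inj e] := ltngtP (rank y') (rank x'); [lia|rewrite e ltnn in lt].
elim/(@finite_value_ind _ tightness): D' => D' IH /agree_offP agr.
have [-> | neD] := eqVneq D' D; [by left | right].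
have SD' x : x \in S -> mate D' x \in S.
  move=> xS; apply: contraLR isT => nS.
  have := agr _ nS; rewrite mateK => e.
  by case/negP: nS; rewrite -(mateK D (mate D' x)) -e; apply: arc_ends_stable.
have [x [xS lty ltw]] : exists x, [/\ x \in S,
    (rank x < rank (mate D' (mate D x)))%N & (rank x < rank (mate D (mate D' x)))%N].
  apply: first_disagreement => [x xS|x xS|].
  - exact/SD'/arc_ends_stable.
  - exact/arc_ends_stable/SD'.
  - apply/exists_inP; apply: contraTT isT => /exists_inPn eqS.
    case/eqP: neD; apply: eq_diagram => x.
    by have [/eqS/negPn/eqP|/agr] := boolP (x \in S).
set y := mate D' (mate D x) in lty; set w := mate D (mate D' x) in ltw.
have yS : y \in S by apply/SD'/arc_ends_stable.
have wS : w \in S by apply/arc_ends_stable/SD'.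
have := decr _ _ xS wS ltw; rewrite /w mateK => ltb.
have nexy : mate D' x != y.
  by rewrite (inj_eq (@mate_inj _ _ D')) eq_sym mate_neq.
have y' : mate D' y = mate D x by rewrite mateK.
pose D2 := relabel (tperm x y) D'.
have lt2 : tightness D2 < tightness D'.
  rewrite tightness_tperm // y' gtrDl pmulr_rlt0; last by lia.
  by lia.
have [|eD2|/lt_trans] := IH D2 lt2; [|by rewrite -eD2|by apply].
apply/agree_offP=> u uS; rewrite mate_relabel tpermV.
have tu v : v \notin S -> tperm x y v = v.
  by move=> vS; rewrite tpermD //; apply: contraNneq vS => <-.
by rewrite (tu u) // agr // tu // mate_stableC //; apply: arc_ends_stable.
Qed.

Section Colouring.
Variable D : diagram k l.

Definition depth x : nat :=
  \max_(Q : {set node k l} | [&& nested D Q, x \in Q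
    & [forall q in Q, (rank q <= rank x)%N]]) #|Q|.

Lemma depth_gt0 x : opener D x -> (0 < depth x)%N.
Proof.
move=> opx; apply: (@leq_trans #|[set x]|); first by rewrite cards1.
apply: (bigop.bigmax_sup [set x]) => //; rewrite set11 /=; apply/andP; split.
  apply/nestedP; split=> [y /set1P->//|y z /set1P-> /set1P->].
  by rewrite ltnn.
by apply/forall_inP=> y /set1P->.
Qed.

(** An arc inside the one opened at [x] prolongs every chain that ends there. *)
Lemma depth_nested x y : opener D x -> opener D y -> (rank x < rank y)%N ->
  (rank (mate D y) < rank (mate D x))%N -> (depth x < depth y)%N.
Proof.
move=> opx opy xy nxy.
have [Q /and3P[nQ xQ /forall_inP leQ] ->] : exists2 Q : {set node k l},
    [&& nested D Q, x \in Q & [forall q in Q, (rank q <= rank x)%N]]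
      & depth x = #|Q|.
  have := depth_gt0 opx; rewrite /depth => gt0.
  have [Q PQ|none] := pickP (fun Q : {set node k l} => [&& nested D Q, x \in Q
    & [forall q in Q, (rank q <= rank x)%N]]).
    have := @bigop.eq_bigmax_cond _ [pred Q : {set node k l} | [&& nested D Q, x \in Q
      & [forall q in Q, (rank q <= rank x)%N]]] (fun Q => #|Q|).
    by case=> [|Q' PQ' e]; [apply/card_gt0P; exists Q | exists Q'].
  by rewrite big_pred0 in gt0.
have /nestedP[op ne] := nQ.
have yQ : y \notin Q by apply: contraTN xy => /leQ; rewrite -leqNgt.
have -> : #|Q|.+1 = #|y |: Q| by rewrite cardsU1 yQ.
apply: (bigop.bigmax_sup (y |: Q)) => //; rewrite setU11 /=; apply/andP; split.
  have inner q : q \in Q -> (rank (mate D y) < rank (mate D q))%N.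
    move=> qQ; have := leQ q qQ; rewrite leq_eqVlt => /orP[/eqP/rank_inj->//|qx].
    by apply: ltn_trans nxy _; apply: ne.
  apply/nestedP; split=> [u /setU1P[->|/op]//|].
  move=> u v /setU1P[->|uQ] /setU1P[->|vQ]; rewrite ?ltnn //.
  - by have := leQ v vQ; lia.
  - by move=> _; apply: inner.
  - exact: ne.
apply/forall_inP=> u /setU1P[->//|/leQ]; lia.
Qed.

Definition level x := depth (if opener D x then x else mate D x).

Lemma level_mate x : level (mate D x) = level x.
Proof. by rewrite /level opener_mate mateK; case: (opener D x). Qed.

Lemma level_bounds c x : (forall Q, nested D Q -> (#|Q| <= c)%N) ->
  (0 < level x <= c)%N.
Proof.
move=> leQ; rewrite /level depth_gt0 /=; last first.
  by case: ifP => // /negbT opx; rewrite opener_mate.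
by apply/bigop.bigmax_leqP=> Q /and3P[/leQ].
Qed.

Lemma level_crossing x y : opener D x -> opener D y -> level x = level y ->
  (rank x < rank y)%N -> (rank (mate D x) < rank (mate D y))%N.
Proof.
rewrite /level => opx opy; rewrite opx opy => eqd xy.
rewrite ltnNge leq_eqVlt; apply/norP; split.
  by apply: contraTneq xy => /rank_inj/mate_inj->; rewrite ltnn.
by apply/negP=> /(depth_nested opx opy xy); rewrite eqd ltnn.
Qed.

Definition compatible D' := forall x,
  level (mate D' x) = level x /\ opener D (mate D' x) = ~~ opener D x.

(** Arcs of equal nesting depth are never nested, so [D] matches the openers of
    each level with the closers in increasing order, which maximises the tightness
    among all the matchings of openers with closers of the same level. *)
Lemma compatible_maximal D' : compatible D' -> D' = D \/ tightness D' < tightness D.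
Proof.
elim/(@finite_value_ind _ (fun D => - tightness D)): D' => D' IH cD'.
have [-> | neD] := eqVneq D' D; [by left | right].
pose O := [set x | opener D x].
have [x [xO lty ltw]] : exists x, [/\ x \in O,
    (rank x < rank (mate D' (mate D x)))%N & (rank x < rank (mate D (mate D' x)))%N].
  apply: first_disagreement => [x|x|].
  - by rewrite !inE (cD' _).2 opener_mate negbK.
  - by rewrite !inE opener_mate (cD' _).2 negbK.
  - apply/exists_inP; apply: contraTT isT => /exists_inPn eqO.
    case/eqP: neD; apply: eq_diagram => x.
    have [xO|xO] := boolP (x \in O); first by have /negPn/eqP := eqO x xO.
    have mO : mate D x \in O by rewrite inE opener_mate; rewrite inE in xO.
    have /negPn/eqP := eqO _ mO; rewrite mateK => e.
    by rewrite -{1}e mateK.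
rewrite inE in xO.
set y := mate D' (mate D x) in lty; set w := mate D (mate D' x) in ltw.
have yO : opener D y by rewrite (cD' _).2 opener_mate xO.
have wO : opener D w by rewrite opener_mate (cD' _).2 xO.
have yl : level y = level x by rewrite (cD' _).1 level_mate.
have wl : level w = level x by rewrite level_mate (cD' _).1.
have := level_crossing xO wO (esym wl) ltw; rewrite /w mateK => ltb.
have nexy : mate D' x != y.
  by rewrite (inj_eq (@mate_inj _ _ D')) eq_sym mate_neq.
have y' : mate D' y = mate D x by rewrite mateK.
pose D2 := relabel (tperm x y) D'.
have lt2 : tightness D' < tightness D2.
  rewrite tightness_tperm // y' ltrDl pmulr_rgt0; last by lia.
  by lia.
have [||eD2|/(lt_trans lt2)//] := IH D2; [by rewrite ltrN2| |by rewrite -eD2].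
move=> u; rewrite -(permKV (tperm x y) u) mate_relabelE; move: (_ u) => {}u.
have tl v : level (tperm x y v) = level v by case: tpermP => [->|->|].
have to v : opener D (tperm x y v) = opener D v.
  by case: tpermP => [->|->|] //; rewrite xO yO.
by rewrite !tl !to; apply: cD'.
Qed.

End Colouring.

End Line.

(** * Pure tensors *)

Section PureTensors.
Variables (K : fieldType) (N : nat).
Local Notation V := 'rV[K]_N.
Local Notation T r := (tpow K N r).

Definition entry r (u : T r) (t : {ffun 'I_r -> 'I_N}) : K := u t.

Lemma entryD r (u v : T r) t : entry (u + v) t = entry u t + entry v t.
Proof. by rewrite /entry ffunE. Qed.

Lemma entryZ r c (u : T r) t : entry (c *: u) t = c * entry u t.
Proof. by rewrite /entry ffunE. Qed.

Lemma entry0 r t : entry (0 : T r) t = 0.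
Proof. by rewrite /entry ffunE. Qed.

Lemma entry_sum r I (s : seq I) (P : pred I) (f : I -> T r) t :
  entry (\sum_(i <- s | P i) f i) t = \sum_(i <- s | P i) entry (f i) t.
Proof.
have := big_morph (fun u : T r => entry u t) (fun u v => entryD u v t) (entry0 t).
exact.
Qed.

Lemma entry_inj r (u v : T r) : entry u =1 entry v -> u = v.
Proof. by move=> e; apply/ffunP. Qed.

Lemma entry_tens r s (u : T r) (v : T s) t :
  entry (tens u v) t
    = entry u [ffun i => t (lshift s i)] * entry v [ffun j => t (rshift r j)].
Proof. by rewrite /entry ffunE. Qed.

Definition ptens r (z : 'I_r -> V) : T r :=
  [ffun t : {ffun 'I_r -> 'I_N} => \prod_i z i 0 (t i)].

Lemma entry_ptens r (z : 'I_r -> V) t : entry (ptens z) t = \prod_i z i 0 (t i).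
Proof. by rewrite /entry ffunE. Qed.

Lemma eq_ptens r (z z' : 'I_r -> V) : z =1 z' -> ptens z = ptens z'.
Proof.
move=> e; apply: entry_inj => t; rewrite !entry_ptens.
by apply: eq_bigr => i _; rewrite e.
Qed.

Lemma ptens_split r s (z : 'I_(r + s) -> V) :
  ptens z = tens (ptens (z \o lshift s)) (ptens (z \o @rshift r s)).
Proof.
apply: entry_inj => t; rewrite entry_tens !entry_ptens big_split_ord /=.
by congr (_ * _); apply: eq_bigr => i _; rewrite ffunE.
Qed.

Lemma ptens1 (z : 'I_1 -> V) : ptens z = tens_vector (z ord0).
Proof.
by apply: entry_inj => t; rewrite entry_ptens big_ord1 /entry ffunE.
Qed.

Lemma ptens2 (z : 'I_2 -> V) : ptens z = tens2 (z ord0) (z ord_max).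
Proof.
rewrite (@ptens_split 1 1) !ptens1 /tens2 /=.
by congr (tens (tens_vector (z _)) (tens_vector (z _))); apply: val_inj.
Qed.

Lemma tens_linearl r s c (u u' : T r) (v : T s) :
  tens (c *: u + u') v = c *: tens u v + tens u' v.
Proof.
apply: entry_inj => t.
by rewrite entryD entryZ !entry_tens entryD entryZ mulrDl mulrA.
Qed.

Lemma tens0l r s (v : T s) : tens (0 : T r) v = 0.
Proof. by apply: entry_inj => t; rewrite entry_tens !entry0 mul0r. Qed.

Lemma tensZr r s c (u : T r) (v : T s) : tens u (c *: v) = c *: tens u v.
Proof.
by apply: entry_inj => t; rewrite entry_tens !entryZ entry_tens mulrCA.
Qed.

Lemma tensZl r s c (u : T r) (v : T s) : tens (c *: u) v = c *: tens u v.
Proof. by rewrite -[c *: u]addr0 tens_linearl tens0l addr0. Qed.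

Lemma tens_sumZl r s I (q : seq I) (P : pred I) (c : I -> K) (f : I -> T r) (v : T s) :
  tens (\sum_(i <- q | P i) c i *: f i) v
    = \sum_(i <- q | P i) c i *: tens (f i) v.
Proof.
elim/big_rec2: _ => [|i y1 y2 _ <-]; first exact: tens0l.
exact: tens_linearl.
Qed.

Definition unit_vectors r (t : {ffun 'I_r -> 'I_N}) (i : 'I_r) : V :=
  delta_mx 0 (t i).

Lemma entry_unit r (t s : {ffun 'I_r -> 'I_N}) :
  entry (ptens (unit_vectors t)) s = (s == t)%:R.
Proof.
rewrite entry_ptens; case: eqP => [->|/eqP ne].
  by rewrite big1 // => i _; rewrite mxE !eqxx.
have [i ne_i] : exists i, s i != t i.
  apply/existsP; apply: contraNT ne => /existsPn e.
  by apply/eqP/ffunP=> i; apply/eqP/negPn/e.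
by rewrite (bigD1 i) //= mxE (negPf ne_i) andbF mul0r.
Qed.

Lemma tpowE r (u : T r) : u = \sum_t entry u t *: ptens (unit_vectors t).
Proof.
apply: entry_inj => s; rewrite entry_sum (bigD1 s) //= entryZ entry_unit eqxx.
rewrite mulr1 big1 ?addr0 // => t /negPf ne.
by rewrite entryZ entry_unit eq_sym ne mulr0.
Qed.

Lemma tens_neq0 (u v : T 0) : (tens u v != 0 :> T 0) = (u != 0) && (v != 0).
Proof.
have all_eq (t t' : {ffun 'I_0 -> 'I_N}) : t = t' by apply/ffunP=> -[].
have t0 : {ffun 'I_0 -> 'I_N} by apply: finfun => -[].
have nz (w : T 0) : (w == 0) = (entry w t0 == 0).
  apply/eqP/eqP => [->|e]; first exact: entry0.
  by apply: entry_inj => t; rewrite (all_eq t t0) e entry0.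
have e : entry (tens u v : T 0) t0 = entry u t0 * entry v t0.
  rewrite [LHS](entry_tens u v).
  by congr (entry u _ * entry v _); apply: all_eq.
by rewrite !nz e mulf_eq0 negb_or.
Qed.

Lemma ptens0_neq0 (z : 'I_0 -> V) : ptens z != 0.
Proof.
have t0 : {ffun 'I_0 -> 'I_N} by apply: finfun => -[].
apply/eqP=> /(congr1 (fun u => entry u t0)) /eqP.
by rewrite entry_ptens big_ord0 entry0 oner_eq0.
Qed.

End PureTensors.

(** * Values of the functor *)

Section FunctorValues.
Variables (K : fieldType) (n : nat).
Local Notation V := 'rV[K]_(2 * n).
Local Notation T r := (tpow K (2 * n) r).
Variables (form : {skew_symmetric V}) (b bbar : (2 * n).-tuple V).
Variable F : forall k l, {linear brauer K k l -> 'Hom(T k, T l)}.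
Hypothesis isF : is_brauer_functor form b bbar F.
Local Notation Fd D := (F _ _ (diag K D)).

Lemma functor_composes k l m (D1 : diagram l m) (D2 : diagram k l) D u :
  composes_to D1 D2 D -> Fd D u = Fd D1 (Fd D2 u).
Proof.
move=> c; rewrite -(bcomp_composes (brauer_parameter K n) c).
by rewrite (functor_comp isF) comp_lfunE.
Qed.

Lemma functorZ k l (x : brauer K k l) c u : F k l x (c *: u) = c *: F k l x u.
Proof. exact: linearZZ. Qed.

Definition signed_perm r (s : 'S_r) := forall z : 'I_r -> V,
  Fd (perm_diagram s) (ptens z) = (-1) ^+ s *: ptens (z \o (s^-1)%g).

Lemma signed_permM r (s t : 'S_r) :
  signed_perm s -> signed_perm t -> signed_perm (s * t).
Proof.
move=> gs gt z.
have c : composes_to (perm_diagram t) (perm_diagram s) (perm_diagram (s * t)).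
  have -> : perm_diagram (s * t) = relabel (rows_perm 1 t) (perm_diagram s).
    apply: eq_diagram => x; rewrite -(permKV (rows_perm 1 t) x) mate_relabelE.
    move: (_ x) => {}x; rewrite !mate_perm !rows_permE.
    by case: x => i /=; rewrite ?perm1 ?permM ?invMg ?permM ?permK.
  exact: composes_perm_l.
apply: etrans (functor_composes _ c) _; apply: etrans (congr1 _ (gs z)) _.
rewrite functorZ gt scalerA -signr_addb odd_permM.
by congr (_ *: _); apply: eq_ptens => i; rewrite /= invMg permM.
Qed.

Lemma signed_perm1 r : signed_perm (1%g : 'S_r).
Proof.
move=> z; rewrite -[perm_diagram 1]/(id_diagram r) (functor_id isF) id_lfunE.
by rewrite odd_perm1 scale1r; apply: eq_ptens => i; rewrite /= invg1 perm1.
Qed.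

Lemma signed_lift r (s : 'S_r) : signed_perm s -> signed_perm (lift0_perm s).
Proof.
move=> gs z; have liftE j : lift ord0 j = rshift 1 j :> 'I_(1 + r) by apply: val_inj.
have s0 : lift0_perm s (lshift r (ord0 : 'I_1)) = lshift r (ord0 : 'I_1).
  have -> : lshift r (ord0 : 'I_1) = ord0 by apply: val_inj.
  exact: lift0_perm0.
have sr j : lift0_perm s (rshift 1 j) = rshift 1 (s j).
  by rewrite -!liftE lift0_perm_lift.
have -> : perm_diagram (lift0_perm s) = tens_diagram diagram_I (perm_diagram s).
  apply: eq_diagram => x; rewrite mate_perm; case: (@node_splitP 1 1 r r x) => -[y ->].
    rewrite (mate_tens_left diagram_I (perm_diagram s)) mate_perm.
    case: y => i /=; rewrite (ord1 i) ?invg1 perm1 ?s0 //.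
    by rewrite -{1}s0 permK.
  rewrite (mate_tens_right diagram_I (perm_diagram s)) mate_perm.
  case: y => i /=; first by rewrite sr.
  by rewrite -{1}(permKV s i) -sr permK.
rewrite (@ptens_split _ _ 1 r).
apply: etrans (functor_tens isF diagram_I (perm_diagram s) _ _) _.
rewrite (functor_I isF) id_lfunE gs tensZr.
rewrite [X in _ = _ *: X](@ptens_split _ _ 1 r) odd_lift_perm /=.
congr (_ *: tens _ _); apply: eq_ptens => i /=; congr (z _).
  by rewrite (ord1 i) -{2}s0 permK.
by rewrite -{2}(permKV s i) -sr permK.
Qed.

Lemma signed_swap r : signed_perm (tperm ord0 (lift ord0 ord0) : 'S_(2 + r)).
Proof.
move=> z; set t := tperm _ _.
have t0 : t (lshift r (ord0 : 'I_2)) = lshift r (ord_max : 'I_2).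
  have -> : lshift r (ord0 : 'I_2) = ord0 :> 'I_(2 + r) by apply: val_inj.
  by rewrite tpermL; apply: val_inj.
have t1 : t (lshift r (ord_max : 'I_2)) = lshift r (ord0 : 'I_2).
  have -> : lshift r (ord_max : 'I_2) = lift ord0 ord0 :> 'I_(2 + r) by apply: val_inj.
  by rewrite tpermR; apply: val_inj.
have tr j : t (rshift 2 j) = rshift 2 j.
  by rewrite tpermD //; apply/eqP=> /(congr1 val).
have tl (j : 'I_2) : t (lshift r j) = lshift r (tperm ord0 ord_max j).
  have [->|->] : j = ord0 \/ j = ord_max.
    by case: j => [[|[|//]] ?]; [left|right]; apply: val_inj.
  - by rewrite t0 tpermL.
  - by rewrite t1 tpermR.
have tV : (t^-1 = t)%g by apply: tpermV.
have -> : perm_diagram t = tens_diagram diagram_X (id_diagram r).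
  apply: eq_diagram => x; rewrite mate_perm; case: (@node_splitP 2 2 r r x) => -[y ->].
    rewrite (mate_tens_left diagram_X (id_diagram r)) mate_perm.
    by case: y => i /=; rewrite ?tV ?tpermV tl.
  rewrite (mate_tens_right diagram_X (id_diagram r)) mate_perm.
  by case: y => i /=; rewrite ?tV ?invg1 perm1 tr.
rewrite (@ptens_split _ _ 2 r).
apply: etrans (functor_tens isF diagram_X (id_diagram r) _ _) _.
rewrite (functor_id isF) id_lfunE.
rewrite ptens2 (functor_X isF) /= odd_tperm /= expr1.
rewrite [X in _ *: X](@ptens_split _ _ 2 r) ptens2 /= tV t0 t1.
rewrite (_ : ptens ((z \o t) \o @rshift 2 r) = ptens (z \o @rshift 2 r)); last first.
  by apply: eq_ptens => j /=; rewrite tr.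
by rewrite -scaleN1r tensZl.
Qed.

(** A transposition of two later factors comes from fewer factors; that of the
    first two is a crossing, and all the other ones are conjugate to it by those
    of the former kind. *)
Lemma signed_tperm r (x y : 'I_r) : signed_perm (tperm x y).
Proof.
have [->|] := eqVneq x y; first by rewrite tperm1; apply: signed_perm1.
elim: r x y => [[]//|r IHr] x y xy.
have lift_t a c : lift0_perm (tperm a c) = tperm (lift ord0 a) (lift ord0 c) :> 'S_r.+1.
  apply/permP=> i; case: (unliftP ord0 i) => [j|] ->.
    by rewrite lift0_perm_lift -inj_tperm //; apply: lift_inj.
  by rewrite lift0_perm0 tpermD.
have IH a c : signed_perm (tperm a c : 'S_r).
  by have [->|/IHr//] := eqVneq a c; rewrite tperm1; apply: signed_perm1.
wlog x0 : x y xy / x = ord0.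
  move=> wlg; case: (unliftP ord0 x) => [a|] xE; last exact: wlg.
  case: (unliftP ord0 y) => [c|] yE; last by rewrite tpermC; apply: wlg; rewrite // eq_sym.
  by rewrite xE yE -lift_t; apply: signed_lift.
rewrite x0 in xy *; case: (unliftP ord0 y) xy => [a ->|->] xy; last by rewrite eqxx in xy.
case: r a {IHr x y x0 xy} IH lift_t => [[]//|r] a IH lift_t.
pose g : 'S_r.+2 := lift0_perm (tperm ord0 a).
have -> : tperm ord0 (lift ord0 a) = (tperm ord0 (lift ord0 ord0) ^ g)%g.
  by rewrite tpermJ lift0_perm0 lift0_perm_lift tpermL.
have gg : signed_perm g by apply: signed_lift.
have gV : (g^-1 = g)%g by rewrite /g lift_t tpermV.
rewrite conjgE gV; apply: (signed_permM gg); apply: signed_permM gg.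
exact: signed_swap.
Qed.

(** Permutations of tensor factors act with the sign of the permutation, since a
    single crossing does. *)
Lemma functor_perm r (s : 'S_r) : signed_perm s.
Proof.
have [ts -> _] := prod_tpermP s.
elim: ts => [|t ts IHts]; first by rewrite big_nil; apply: signed_perm1.
by rewrite big_cons; apply: signed_permM IHts; apply: signed_tperm.
Qed.

Lemma functor_relabel m (D : diagram m 0) (s : 'S_m) z :
  Fd (relabel (rows_perm s^-1 1) D) (ptens z)
    = (-1) ^+ s *: Fd D (ptens (z \o (s^-1)%g)).
Proof.
apply: etrans (functor_composes _ (composes_perm_r s D)) _.
by apply: etrans (congr1 _ (functor_perm s z)) _; rewrite functorZ.
Qed.

(** * Multilinear forms of the diagrams without upper nodes *)

Definition pairs_nonzero m (D : diagram m 0) (z : 'I_m -> V) :=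
  forall i j, mate D (inl i) = inl j -> form (z i) (z j) != 0.

Fixpoint caps r : diagram r.*2 0 :=
  if r is r'.+1 then tens_diagram diagram_A (caps r') else id_diagram 0.

Lemma caps_neq0 r (z : 'I_r.*2 -> V) :
  Fd (caps r) (ptens z) != 0 <-> pairs_nonzero (caps r) z.
Proof.
elim: r z => [|r IHr] z.
  rewrite -[caps 0]/(id_diagram 0) (functor_id isF) id_lfunE ptens0_neq0.
  by split=> // _ [].
have mateA (x y : node 2 0) : x != y -> mate diagram_A x = y.
  move=> xy; apply/esym/eqP; rewrite -arc_mate /= inE eqEcard subsetT.
  by rewrite cardsT card_node cards2 xy.
pose zl : 'I_2 -> V := fun i => z (lshift r.*2 i).
pose zr : 'I_r.*2 -> V := fun i => z (rshift 2 i).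
have -> : Fd (caps r.+1) (ptens z) = tens (Fd diagram_A (ptens zl)) (Fd (caps r) (ptens zr)).
  rewrite (@ptens_split _ _ 2 r.*2).
  exact: (functor_tens isF diagram_A (caps r)).
rewrite tens_neq0.
rewrite ptens2 (functor_A isF).
have t0 : {ffun 'I_0 -> 'I_(2 * n)} by apply: finfun => -[].
have -> c : (tens_scalar (2 * n) c != 0) = (c != 0).
  congr negb; apply/eqP/eqP => [/(congr1 (fun u => entry u t0))|->].
    by rewrite entry0 /entry /tens_scalar ffunE.
  by apply: entry_inj => t; rewrite [RHS]entry0 /entry /tens_scalar ffunE.
set a0 := lshift r.*2 (ord0 : 'I_2); set a1 := lshift r.*2 (ord_max : 'I_2).
have m01 : mate (tens_diagram diagram_A (caps r)) (inl a0) = inl a1.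
  have := mate_tens_left diagram_A (caps r) (inl ord0).
  by rewrite (mateA _ (inl ord_max)).
split=> [/andP[nz /IHr nz'] i j|nz]; last first.
  rewrite (nz _ _ m01) /=; apply/IHr => i j ij; apply: nz.
  by have := mate_tens_right diagram_A (caps r) (inl i); rewrite ij.
have low (x : node 2 0) : x = inl ord0 \/ x = inl ord_max.
  by case: x => [[[|[|//]] ?]|[]//]; [left|right]; congr inl; apply: val_inj.
rewrite -(@splitK 2 r.*2 i); case: (split _) => i' /=.
  have -> : mate (tens_diagram diagram_A (caps r)) (inl (lshift r.*2 i'))
      = left_node r.*2 0 (mate diagram_A (inl i')).
    exact: (mate_tens_left diagram_A (caps r) (inl i')).
  have [e|e] := low (inl i'); rewrite e; case: e => ->.
    by rewrite (mateA _ (inl ord_max)) //= => -[<-].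
  by rewrite (mateA _ (inl ord0)) //= => -[<-]; rewrite herm_eq0C.
have -> : mate (tens_diagram diagram_A (caps r)) (inl (rshift 2 i'))
    = right_node 2 0 (mate (caps r) (inl i')).
  exact: (mate_tens_right diagram_A (caps r) (inl i')).
case ij: (mate (caps r) (inl i')) => [j'|[]//] /= -[<-].
exact: nz'.
Qed.

(** All matchings of the lower nodes are relabellings of one another, which
    changes the value by a sign. *)
Lemma functor_neq0 m (D : diagram m 0) (z : 'I_m -> V) :
  Fd D (ptens z) != 0 <-> pairs_nonzero D z.
Proof.
have [r mE] : exists r, m = r.*2.
  have [/(card_uniform_partition _) cP /forall_inP P2] := andP (arcsP D).
  have := cP 2%N (fun B BD => eqP (P2 B BD)).
  by rewrite cardsT card_node addn0 muln2 => ->; exists #|arcs D|.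
subst m; have [a c|p pu ->] := @relabel_transitive _ _ _ (@is_upper r.*2 0) D (caps r).
  apply: eq_card => x; rewrite !inE.
  by case: (mate D x) => [?|[]//]; case: (mate _ x) => [?|[]//].
have [s [t {p pu}->]] := rows_permP pu.
have -> : rows_perm s t = rows_perm ((s^-1)^-1)%g 1.
  by apply/permP=> x; rewrite !rows_permE invgK; case: x => [//|[]].
rewrite functor_relabel scaler_eq0 signr_eq0 /=.
rewrite caps_neq0 invgK; split=> nz i j.
  rewrite -(permKV s i) -(permKV s j) => e; apply: nz.
  move: e; have sE y : inl (s y) = rows_perm s (1 : 'S_0) (inl y) by rewrite rows_permE.
  by rewrite !sE mate_relabelE => /perm_inj.
move=> ij; apply: nz.
have sE y : inl (s y) = rows_perm s (1 : 'S_0) (inl y) by rewrite rows_permE.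
by rewrite !sE mate_relabelE ij.
Qed.

(** * Bending the upper nodes down *)

Section Bend.
Variable r : nat.
Implicit Types D : diagram r r.

Section BendDiagram.
Variable D : diagram r r.
Let f (x : node (r + r) 0) : node (r + r) 0 :=
  match x with inl i => inl (unsplit (mate D (split i))) | inr j => inr j end.
Let fK : involutive f.
Proof. by case=> //= i; rewrite unsplitK mateK splitK. Qed.
Let fx x : f x != x.
Proof.
case: x => [i|[]//]; rewrite /f -[X in _ != inl X]splitK.
apply/eqP=> -[/(can_inj (@unsplitK _ _)) /eqP]; exact/negP/mate_neq.
Qed.

(** The diagram [D] with its upper nodes appended to the lower ones; [split]
    recovers the node of [D] behind a node of the row. *)
Definition bend : diagram (r + r) 0 := Diagram (involution_pairing fK fx).

Lemma mate_bend x : mate bend (inl (unsplit x)) = inl (unsplit (mate D x)).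
Proof. by rewrite mate_involution /= unsplitK. Qed.

End BendDiagram.

(** Each strand of the identity on the right runs up to the middle row, where an
    arc of the bent identity leads it back to an upper node of [D]. *)
Lemma composes_bend D :
  composes_to (bend (id_diagram r)) (tens_diagram D (id_diagram r)) (bend D).
Proof.
set c := connect (stack_adj (bend (id_diagram r)) (tens_diagram D (id_diagram r))).
have cc x y : c x y -> c y x by rewrite /c conn_sym.
have below := conn_below (bend (id_diagram r)) (tens_diagram D (id_diagram r)).
have above := conn_above (bend (id_diagram r)) (tens_diagram D (id_diagram r)).
have vert j : c (inl (inl (rshift r j))) (inl (inr (rshift r j))).
  have := below (right_node r r (inl j)); rewrite mate_tens_right mate_perm /= perm1.
  exact.
have turn j : c (inl (inr (rshift r j))) (inl (inr (lshift r j))).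
  have := above (inl (unsplit (inr j))); rewrite mate_bend mate_perm /= invg1 perm1.
  exact.
have out (x : node r r) :
    c (stack_outer (r + r) (inl (unsplit x))) (stack_below 0 (left_node r r x)).
  case: x => j; first exact: connect0.
  exact: connect_trans (vert j) (turn j).
apply: composesP => [x|i].
  case: x => [i|[]//]; rewrite -(splitK i) mate_bend.
  apply: connect_trans (out _) _; apply: connect_trans (below _) _.
  by rewrite mate_tens_left; apply: cc.
exists (inl (unsplit (inr (match split i with inl j => j | inr j => j end)))).
rewrite -{2}(splitK i); case: (split i) => j.
  exact: connect_trans (vert j) (turn j).
exact: vert.
Qed.

Lemma functor_bend D (u v : T r) :
  Fd (bend D) (tens u v) = Fd (bend (id_diagram r)) (tens (Fd D u) v).
Proof.
apply: etrans (functor_composes _ (composes_bend D)) _; apply: congr1.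
by apply: etrans (functor_tens isF _ _ _ _) _; rewrite (functor_id isF) id_lfunE.
Qed.

Lemma functor_brauerE (x : brauer K r r) u :
  F r r x u = \sum_D bcoef x D *: Fd D u.
Proof.
rewrite {1}(brauerE x) linear_sum sum_lfunE; apply: eq_bigr => D _.
by rewrite linearZ /= scale_lfunE.
Qed.

Lemma functor_bend_sum (x : brauer K r r) (u v : T r) :
  \sum_D bcoef x D *: Fd (bend D) (tens u v)
    = Fd (bend (id_diagram r)) (tens (F r r x u) v).
Proof.
rewrite functor_brauerE tens_sumZl.
apply: etrans _ (esym (linear_sum _ _ _ _)); apply: eq_bigr => D _.
by rewrite functor_bend; apply/esym/functorZ.
Qed.

End Bend.

End FunctorValues.

(** * Symplectic vectors *)

Section Symplectic.
Variables (K : fieldType) (n : nat).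
Local Notation V := 'rV[K]_(2 * n).
Variables (form : {skew_symmetric V}) (b bbar : (2 * n).-tuple V).
Hypothesis char0 : [pchar K] =i pred0.
Hypothesis dual : dual_bases form b bbar.

Lemma form_anti u v : form u v = - form v u.
Proof. by rewrite hermC /= expr1 mulN1r. Qed.

Lemma formDl u v w : form (u + v) w = form u w + form v w.
Proof. exact: linearDl. Qed.

Lemma formZl c u w : form (c *: u) w = c * form u w.
Proof. exact: linearZl. Qed.

Lemma formZr c u w : form w (c *: u) = c * form w u.
Proof. by rewrite form_anti formZl -mulrN -form_anti. Qed.

Lemma form0l w : form 0 w = 0.
Proof. by rewrite -(scale0r 0) formZl mul0r. Qed.

Lemma form_suml I (r : seq I) (P : pred I) (f : I -> V) w :
  form (\sum_(i <- r | P i) f i) w = \sum_(i <- r | P i) form (f i) w.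
Proof.
exact: (big_morph (fun u => form u w) (fun u v => formDl u v w) (form0l w)).
Qed.

Lemma form_sumr I (r : seq I) (P : pred I) (f : I -> V) w :
  form w (\sum_(i <- r | P i) f i) = \sum_(i <- r | P i) form w (f i).
Proof.
by rewrite form_anti form_suml -sumrN; apply: eq_bigr => i _; rewrite -form_anti.
Qed.

Lemma natr_neq0 m : (m.+1%:R : K) != 0.
Proof. by rewrite (proj1 (pcharf0P K) char0). Qed.

Lemma formvv v : form v v = 0.
Proof.
apply/eqP; have := form_anti v v => /eqP; rewrite -addr_eq0 -mulr2n -mulr_natl.
by rewrite mulf_eq0 (negPf (natr_neq0 1)).
Qed.

(** The dual bases exhibit every coordinate as the pairing with a vector; in
    particular the form is non-degenerate. *)
Lemma coordinate_form j : exists w, forall v, form v w = v 0 j.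
Proof.
have [basb dualb] := dual.
exists (- \sum_k tnth b k 0 j *: tnth bbar k) => v.
rewrite -scaleN1r formZr mulN1r -form_anti form_suml.
have vE : v = \sum_k coord b k v *: tnth b k.
  rewrite {1}(coord_basis basb (memvf v)); apply: eq_bigr => k _.
  by rewrite (tnth_nth 0).
rewrite [in RHS]vE summxE; apply: eq_bigr => k _; rewrite formZl mxE mulrC.
congr (_ * _); rewrite {1}vE form_sumr (bigD1 k) //= formZr dualb eqxx mulr1.
rewrite big1 ?addr0 // => i /negPf ne.
by rewrite formZr dualb eq_sym ne mulr0.
Qed.

Lemma orthogonal_vector m (f : 'I_m -> V) : (m < 2 * n)%N ->
  exists2 v, v != 0 & forall i, form v (f i) = 0.
Proof.
move=> ltm; pose A : 'M[K]_(2 * n, m) := \matrix_(i, j) form (delta_mx 0 i) (f j).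
have : kermx A != 0.
  rewrite -mxrank_eq0 mxrank_ker subn_eq0 -ltnNge.
  by apply: leq_ltn_trans (rank_leq_col A) ltm.
rewrite -nz_row_eq0 => nz; exists (nz_row (kermx A)) => // j.
have /sub_kermxP/matrixP/(_ 0 j) := nz_row_sub (kermx A).
rewrite mxE [in RHS]mxE => <-.
rewrite {1}(row_sum_delta (nz_row (kermx A))) form_suml.
by apply: eq_bigr => i _; rewrite formZl mxE.
Qed.

(** Fewer than n pairs leave a non-zero vector orthogonal to them, for reasons of
    dimension; a partner for it is made orthogonal to the previous pairs by
    subtracting its components along them. *)
Lemma symplectic_family m : (m <= n)%N -> exists p q : nat -> V,
  forall i j, (i < m)%N -> (j < m)%N ->
    [/\ form (p i) (p j) = 0, form (q i) (q j) = 0 & form (p i) (q j) = (i == j)%:R].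
Proof.
elim: m => [_|m IHm ltm]; first by exists (fun=> 0), (fun=> 0).
have [p [q pq]] := IHm (ltnW ltm).
pose f (i : 'I_(m + m)) := match split i with inl a => p a | inr a => q a end.
have [|v vn0 orth] := @orthogonal_vector _ f; first by lia.
have vp i : (i < m)%N -> form v (p i) = 0.
  by move=> lti; have := orth (unsplit (inl (Ordinal lti))); rewrite /f unsplitK.
have vq i : (i < m)%N -> form v (q i) = 0.
  by move=> lti; have := orth (unsplit (inr (Ordinal lti))); rewrite /f unsplitK.
have [j vj] : exists j, v 0 j != 0.
  apply/existsP; apply: contraNT vn0 => /existsPn v0; apply/eqP/rowP=> j.
  by rewrite mxE; apply/eqP/negPn/v0.
have [w wE] := coordinate_form j.
pose w1 := w + (\sum_(i < m) form w (p i) *: q i - \sum_(i < m) form w (q i) *: p i).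
have w1E u : form w1 u = form w u + (\sum_(i < m) form w (p i) * form (q i) u
    - \sum_(i < m) form w (q i) * form (p i) u).
  rewrite /w1 !formDl -scaleN1r formZl mulN1r !form_suml.
  by congr (_ + (_ - _)); apply: eq_bigr => i _; rewrite formZl.
have sum0 (c g : nat -> K) : (forall i, (i < m)%N -> g i = 0) ->
    \sum_(i < m) c i * g i = 0.
  by move=> g0; rewrite big1 // => i _; rewrite g0 ?mulr0.
have sum1 (c g : nat -> K) a k : (a < m)%N ->
    (forall i, (i < m)%N -> g i = (i == a)%:R * k) ->
    \sum_(i < m) c i * g i = c a * k.
  move=> lta ga; rewrite (bigD1 (Ordinal lta)) //= ga // eqxx mul1r.
  rewrite big1 ?addr0 // => i ne; rewrite ga // (_ : (i == a :> nat) = false).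
    by rewrite mul0r mulr0.
  by apply: contraNF ne => /eqP e; apply/eqP/val_inj.
pose wp i := form w (p i); pose wq i := form w (q i).
have w1p a : (a < m)%N -> form w1 (p a) = 0.
  move=> lta; rewrite w1E.
  have -> : \sum_(i < m) form w (q i) * form (p i) (p a) = 0.
    by apply: (sum0 wq (fun i => form (p i) (p a))) => i lti; case: (pq i a lti lta).
  have -> : \sum_(i < m) form w (p i) * form (q i) (p a) = form w (p a) * -1.
    apply: (sum1 wp (fun i => form (q i) (p a))) => // i lti.
    by rewrite form_anti; case: (pq a i lta lti) => _ _ ->; rewrite eq_sym mulrN1.
  by rewrite subr0 mulrN1 subrr.
have w1q a : (a < m)%N -> form w1 (q a) = 0.
  move=> lta; rewrite w1E.
  have -> : \sum_(i < m) form w (p i) * form (q i) (q a) = 0.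
    by apply: (sum0 wp (fun i => form (q i) (q a))) => i lti; case: (pq i a lti lta).
  have -> : \sum_(i < m) form w (q i) * form (p i) (q a) = form w (q a) * 1.
    apply: (sum1 wq (fun i => form (p i) (q a))) => // i lti.
    by case: (pq i a lti lta) => _ _ ->; rewrite mulr1.
  by rewrite sub0r mulr1 subrr.
have w1v : form w1 v = form w v.
  rewrite w1E.
  have -> : \sum_(i < m) form w (p i) * form (q i) v = 0.
    by apply: (sum0 wp (fun i => form (q i) v)) => i lti; rewrite form_anti vq ?oppr0.
  have -> : \sum_(i < m) form w (q i) * form (p i) v = 0.
    by apply: (sum0 wq (fun i => form (p i) v)) => i lti; rewrite form_anti vp ?oppr0.
  by rewrite subr0 addr0.
have vw : form v w1 = v 0 j by rewrite form_anti w1v -form_anti.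
pose c := (v 0 j)^-1.
exists (fun i => if i == m then v else p i), (fun i => if i == m then c *: w1 else q i).
move=> i k; rewrite !ltnS [(i <= m)%N]leq_eqVlt [(k <= m)%N]leq_eqVlt.
have ltF a : (a < m)%N -> (a == m) = false by move=> lta; lia.
case/orP=> [/eqP->|lti] /orP[/eqP->|ltk]; rewrite ?eqxx ?ltF //.
- by rewrite !formvv formZr vw mulVf.
- by rewrite vp // formZl w1q // mulr0 vq // eq_sym ltF.
- by rewrite form_anti vp // oppr0 !formZr form_anti w1q // form_anti w1p // !oppr0 !mulr0.
- exact: pq.
Qed.

End Symplectic.

(** * The kernel of the functor *)

Section Kernel.
Variables (K : fieldType) (n : nat).
Local Notation V := 'rV[K]_(2 * n).
Local Notation T r := (tpow K (2 * n) r).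
Variables (form : {skew_symmetric V}) (b bbar : (2 * n).-tuple V).
Variable F : forall k l, {linear brauer K k l -> 'Hom(T k, T l)}.
Hypothesis char0 : [pchar K] =i pred0.
Hypothesis dual : dual_bases form b bbar.
Hypothesis isF : is_brauer_functor form b bbar F.
Local Notation Fd D := (F _ _ (diag K D)).

(** Pairing the upper tensor factors with coordinate vectors through the bent
    identity recovers all coordinates of the image. *)
Lemma kernel_bend r (x : brauer K r r) :
  F r r x = 0 <-> forall z, \sum_D bcoef x D *: Fd (bend D) (ptens z) = 0.
Proof.
split=> [Fx0 z | bend0].
  rewrite ptens_split (functor_bend_sum isF) Fx0 zero_lfunE tens0l.
  exact: linear0.
have unit0 t : F r r x (ptens (unit_vectors K t)) = 0.
  apply: entry_inj => s; rewrite entry0; set v := F r r x _.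
  have [w wE] : exists w : 'I_r -> V, forall i u, form u (w i) = u 0 (s i).
    have /fin_all_exists[w wE] : forall i : 'I_r, exists w, forall u, form u w = u 0 (s i).
      by move=> i; apply: coordinate_form dual _.
    by exists w.
  pose z (u : 'I_r -> V) (i : 'I_(r + r)) :=
    match split i with inl a => u a | inr a => w a end.
  have zE u : ptens (z u) = tens (ptens u) (ptens w).
    rewrite ptens_split; congr tens; apply: eq_ptens => i /=.
      by rewrite /z -[lshift r i]/(unsplit (inl i)) unsplitK.
    by rewrite /z -[rshift r i]/(unsplit (inr i)) unsplitK.
  have := bend0 (z (unit_vectors K t)); rewrite zE (functor_bend_sum isF) -/v.
  have capz s' : Fd (bend (id_diagram r)) (ptens (z (unit_vectors K s'))) != 0 <-> s' = s.
    rewrite (functor_neq0 isF); split=> [nz|-> i j].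
      apply/ffunP=> i; have := nz (unsplit (inl i)) (unsplit (inr i)).
      rewrite mate_bend mate_perm /= perm1 /z -[lshift r i]/(unsplit (inl i)).
      rewrite -[rshift r i]/(unsplit (inr i)) !unsplitK wE mxE eqxx /=.
      by case: (s i =P s' i) => [->//|_ /(_ erefl)/eqP].
    rewrite -(splitK i) mate_bend mate_perm /z => -[<-]; rewrite !unsplitK.
    case: (split i) => a /=; rewrite ?invg1 perm1; last rewrite herm_eq0C.
      by rewrite wE mxE !eqxx oner_eq0.
    by rewrite wE mxE !eqxx oner_eq0.
  rewrite {1}(tpowE v) tens_sumZl linear_sum (bigD1 s) //= big1 => [|s' ne].
    rewrite addr0 linearZ /= -zE => /eqP; rewrite scaler_eq0.
    have /capz/negPf-> := erefl s; by rewrite orbF => /eqP.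
  rewrite linearZ /= -zE.
  suff /eqP-> : Fd (bend (id_diagram r)) (ptens (z (unit_vectors K s'))) == 0.
    by rewrite scaler0.
  by apply: contraNT ne => /capz ->.
apply/lfunP=> u; rewrite zero_lfunE (tpowE u) linear_sum big1 // => t _.
by rewrite linearZ /= unit0 scaler0.
Qed.

(** The sum of all diagrams is invariant under every relabelling, so after
    bending it is an alternating multilinear form in 2n + 2 vectors of a space of
    dimension 2n. *)
Lemma sum_all_kernel : F n.+1 n.+1 (\sum_D diag K D) = 0.
Proof.
apply/kernel_bend => z; pose G : 'Hom(T (n.+1 + n.+1), T 0) :=
  \sum_(D : diagram n.+1 n.+1) Fd (bend D).
have coef1 D : bcoef (\sum_(D : diagram n.+1 n.+1) diag K D) D = 1.
  have /= e := sum_diag_bcoef predT (fun=> 1 : K) D; rewrite -[RHS]e.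
  by congr bcoef; apply: eq_bigr => D' _; rewrite scale1r.
have GE u : G u = \sum_(D : diagram n.+1 n.+1) Fd (bend D) u by rewrite sum_lfunE.
transitivity (G (ptens z)).
  by rewrite GE; apply: eq_bigr => D _; rewrite coef1 scale1r.
rewrite (tpowE (ptens z)) linear_sum big1 // => t _; rewrite linearZ /=.
suff -> : G (ptens (unit_vectors K t)) = 0 by rewrite scaler0.
have [a [c [ac tac]]] : exists a c, a != c /\ t a = t c.
  have /injectivePn[a [c ac tac]] : ~~ injectiveb t.
    apply/negP=> /injectiveP/leq_card; rewrite !card_ord; lia.
  by exists a, c.
set u := unit_vectors K t; pose s := tperm a c.
have us : ptens (u \o s) = ptens u.
  apply: eq_ptens => i; rewrite /= /u /unit_vectors /s.
  by case: tpermP => [->|->|//]; rewrite ?tac.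
suff GN : G (ptens u) = - G (ptens u).
  apply/eqP; move/eqP: GN; rewrite -addr_eq0 -mulr2n -scaler_nat scaler_eq0.
  by rewrite (negPf (natr_neq0 char0 1)).
pose p : {perm node n.+1 n.+1} := tperm (split a) (split c).
rewrite !GE -sumrN (reindex_inj (bij_inj (relabel_bij p))) /=.
apply: eq_bigr => D _.
have -> : bend (relabel p D) = relabel (rows_perm s^-1 1) (bend D).
  have unsplit_p x : inl (unsplit (p x)) = rows_perm s^-1 (1 : 'S_0) (inl (unsplit x)).
    rewrite rows_permE /= /s tpermV /p (inj_tperm _ _ _ (can_inj (@unsplitK _ _))).
    by rewrite !splitK.
  apply: eq_diagram => -[i|[]//]; rewrite -(splitK i) -(permKV p (split i)).
  by rewrite mate_bend mate_relabelE !unsplit_p mate_relabelE mate_bend.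
rewrite (functor_relabel isF) /s tpermV us odd_tperm ac expr1.
by rewrite scaleN1r.
Qed.

End Kernel.

(** * Independence and straightening *)

Section Main.
Variables (K : fieldType) (n : nat).
Local Notation V := 'rV[K]_(2 * n).
Local Notation T r := (tpow K (2 * n) r).
Variables (form : {skew_symmetric V}) (b bbar : (2 * n).-tuple V).
Variable F : forall k l, {linear brauer K k l -> 'Hom(T k, T l)}.
Hypothesis char0 : [pchar K] =i pred0.
Hypothesis dual : dual_bases form b bbar.
Hypothesis isF : is_brauer_functor form b bbar F.
Variable r : nat.
Local Notation Fd D := (F _ _ (diag K D)).
Implicit Types (D : diagram r r) (x y : brauer K r r).

Definition row_rank (x : node r r) : nat := unsplit x.

Lemma row_rank_inj : injective row_rank.
Proof. exact: inj_comp (@ord_inj _) (can_inj (@unsplitK r r)). Qed.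

Definition shallow D :=
  [forall Q : {set node r r}, nested row_rank D Q ==> (#|Q| <= n)%N].

Lemma shallowP D :
  reflect (forall Q, nested row_rank D Q -> (#|Q| <= n)%N) (shallow D).
Proof.
by apply: (iffP forallP) => h Q; have /implyP := h Q.
Qed.

Definition shallow_supported x := forall D, ~~ shallow D -> bcoef x D = 0.

(** Evaluate on symplectic vectors: p_i on the openers and q_i on the closers of
    level i of [D].  Only compatible diagrams survive, and [D] is the one of
    largest tightness among them, so its coefficient vanishes as soon as those of
    smaller tightness do. *)
Lemma shallow_free x : shallow_supported x -> F r r x = 0 -> x = 0.
Proof.
move=> sx /(kernel_bend dual isF) Fx0; apply: bcoef_inj => D; rewrite bcoef0.
have [p [q pq]] := symplectic_family char0 dual (leqnn n).
elim/(@finite_value_ind _ (tightness row_rank)): D => D IH.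
have [/shallowP shD|/sx//] := boolP (shallow D).
pose lev := level row_rank D; pose op := opener row_rank D.
have lev_bd u : (0 < lev u <= n)%N by apply: level_bounds row_rank_inj _ _ _ shD.
pose g u := if op u then p (lev u).-1 else q (lev u).-1.
have gE u v : (form (g u) (g v) != 0) = (op u != op v) && (lev u == lev v).
  have /andP[u0 un] := lev_bd u; have /andP[v0 vn] := lev_bd v.
  have ltu : ((lev u).-1 < n)%N by lia.
  have ltv : ((lev v).-1 < n)%N by lia.
  have eqlev : ((lev u).-1 == (lev v).-1) = (lev u == lev v) by lia.
  have [pp qq pqE] := pq _ _ ltu ltv; have [_ _ qpE] := pq _ _ ltv ltu.
  rewrite /g; case: (op u); case: (op v); rewrite ?pp ?qq ?eqxx //=.
    by rewrite pqE eqlev; case: (lev u == lev v); rewrite ?oner_eq0 ?eqxx.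
  rewrite form_anti qpE [(lev v).-1 == _]eq_sym eqlev oppr_eq0.
  by case: (lev u == lev v); rewrite ?oner_eq0 ?eqxx.
pose z (i : 'I_(r + r)) := g (split i).
have nzE D' : Fd (bend D') (ptens z) != 0 <->
    forall u, (op u != op (mate D' u)) && (lev u == lev (mate D' u)).
  rewrite (functor_neq0 isF); split=> nz; last first.
    move=> i j; rewrite -{1}(splitK i) mate_bend => -[<-].
    by rewrite /z unsplitK gE.
  move=> u; have := nz _ _ (mate_bend D' u).
  by rewrite /z !unsplitK gE.
have := Fx0 z; rewrite (bigD1 D) //= big1 => [|D' neD].
  rewrite addr0 => /eqP; rewrite scaler_eq0 => /orP[/eqP//|/negPn/negP[]].
  apply/nzE => u; rewrite /op (opener_mate row_rank_inj) /lev level_mate; last exact: row_rank_inj.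
  by rewrite eqxx andbT; case: (opener _ _ _).
have [/eqP->|/nzE comp] := boolP (Fd (bend D') (ptens z) == 0); first by rewrite scaler0.
have [|eD|lt] := @compatible_maximal _ _ _ row_rank_inj D D'.
- move=> u; have /andP[neq /eqP e] := comp u; split; first by rewrite -/lev e.
  by move: neq; rewrite /op; do 2!case: (opener _ _ _).
- by rewrite eD eqxx in neD.
- by rewrite IH // scale0r.
Qed.

Lemma subset_of_card (A : finType) (B : {set A}) c : (c <= #|B|)%N ->
  exists2 C : {set A}, C \subset B & #|C| = c.
Proof.
elim: c => [|c IHc] ltc; first by exists set0; rewrite ?sub0set ?cards0.
have [C sCB cC] := IHc (ltnW ltc).
have /properP[_ [a aB aC]] : C \proper B by rewrite properEcard sCB cC.
exists (a |: C); first by rewrite subUset sub1set aB.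
by rewrite cardsU1 aC cC.
Qed.

Lemma diagram_shallow D : (r <= n)%N -> shallow D.
Proof.
move=> lern; apply/shallowP=> Q nQ; apply: leq_trans lern.
have := max_card (mem (arc_ends D Q)); rewrite card_node.
by rewrite (card_arc_ends row_rank_inj nQ); lia.
Qed.

Section Generated.
Variable g : brauer K r r.
Local Notation J := (in_generated_ideal (brauer_parameter K n) g).

Lemma generated_two_sided : two_sided_ideal (brauer_parameter K n) J.
Proof.
split=> [I idI gI|x y Jx Jy I idI gI|c x Jx I idI gI|y x Jx I idI gI|y x Jx I idI gI].
- exact: Defs.ideal0 idI.
- by apply: (Defs.idealD idI); [apply: Jx | apply: Jy].
- by apply: (Defs.idealZ idI); apply: Jx.
- by apply: (Defs.idealMl idI); apply: Jx.
- by apply: (Defs.idealMr idI); apply: Jx.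
Qed.

Lemma generated_kernel x : F r r g = 0 -> J x -> F r r x = 0.
Proof.
move=> Fg Jx; apply: (Jx (fun y => F r r y = 0)) => //.
split=> [|y z Fy Fz|c y Fy|z y Fy|z y Fy].
- exact: linear0.
- by rewrite linearD /= Fy Fz addr0.
- by rewrite linearZ /= Fy scaler0.
- by rewrite (functor_comp isF) Fy comp_lfun0r.
- by rewrite (functor_comp isF) Fy comp_lfun0l.
Qed.

Definition straightens x := exists2 y, shallow_supported y & J (x - y).

Lemma straightens_linear c x x' :
  straightens x -> straightens x' -> straightens (c *: x + x').
Proof.
case=> y sy Jy [y' sy' Jy']; exists (c *: y + y').
  by move=> D nD; rewrite bcoefD bcoefZ sy // sy' // mulr0 addr0.
have -> : c *: x + x' - (c *: y + y') = c *: (x - y) + (x' - y').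
  by rewrite scalerBr opprD addrACA.
apply: (Defs.idealD generated_two_sided) => //.
exact: (Defs.idealZ generated_two_sided).
Qed.

Lemma straightens0 : straightens 0.
Proof.
exists 0; first by move=> D _; rewrite bcoef0.
by rewrite subr0; apply: (Defs.ideal0 generated_two_sided).
Qed.

Lemma straightens_sum I (s : seq I) (P : pred I) (c : I -> K) (f : I -> brauer K r r) :
  (forall i, P i -> straightens (f i)) ->
  straightens (\sum_(i <- s | P i) c i *: f i).
Proof.
move=> sf; elim/big_rec: _ => [|i y Pi sy]; first exact: straightens0.
by apply: straightens_linear => //; apply: sf.
Qed.

Hypothesis local_J : forall D S,
  mate_stable D S -> #|S| = (2 * n.+1)%N -> J (local_sum K D S).

(** When n + 1 arcs of [D] are nested, the sum over all rematchings of their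
    ends lies in the ideal, and all its other terms have larger tightness. *)
Lemma straightens_diag D : straightens (diag K D).
Proof.
elim/(@finite_value_ind _ (fun D => - tightness row_rank D)): D => D IH.
have [shD|/forallPn[Q]] := boolP (shallow D).
  exists (diag K D); last by rewrite subrr; apply: (Defs.ideal0 generated_two_sided).
  by move=> D' nD'; rewrite bcoef_diag; case: eqP => // e; rewrite e shD in nD'.
rewrite negb_imply -ltnNge => /andP[nQ ltQ].
have [C sCQ cC] := subset_of_card ltQ.
have nC : nested row_rank D C.
  have /nestedP[opQ neQ] := nQ; apply/nestedP; split=> [u uC|u v uC vC].
    exact/opQ/(subsetP sCQ).
  by apply: neQ; apply: (subsetP sCQ).
pose S := arc_ends D C.
have JS : J (local_sum K D S).
  apply: local_J; first exact: arc_ends_stable.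
  by rewrite (card_arc_ends row_rank_inj nC) cC.
have DS : D \in agree_off S D by apply/agree_offP.
have sumE : local_sum K D S
    = diag K D + \sum_(D' in agree_off S D | D' != D) diag K D'.
  by rewrite /local_sum (bigD1 D).
have -> : diag K D
    = 1 *: local_sum K D S + \sum_(D' in agree_off S D | D' != D) -1 *: diag K D'.
  by rewrite sumE scale1r -scaler_sumr scaleN1r addrK.
apply: straightens_linear.
  by exists 0; [move=> D' _; rewrite bcoef0 | rewrite subr0].
apply: straightens_sum => D' /andP[agr neD]; apply: IH; rewrite ltrN2.
have [e|//] := nested_minimal row_rank_inj nC agr.
by rewrite e eqxx in neD.
Qed.

Lemma kernel_generated x : F r r g = 0 -> F r r x = 0 -> J x.
Proof.
move=> Fg Fx; have [y sy Jy] : straightens x.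
  by rewrite (brauerE x); apply: straightens_sum => D _; apply: straightens_diag.
suff y0 : y = 0 by rewrite y0 subr0 in Jy.
apply: shallow_free => //; have := generated_kernel Fg Jy.
by rewrite linearB /= Fx sub0r => /eqP; rewrite oppr_eq0 => /eqP.
Qed.

End Generated.

End Main.

Theorem theorem5p9 (K : fieldType) (n : nat)
    (form : {skew_symmetric 'rV[K]_(2 * n)})
    (b bbar : (2 * n).-tuple 'rV[K]_(2 * n))
    (F : forall k l : nat,
       {linear brauer K k l -> 'Hom(tpow K (2 * n) k, tpow K (2 * n) l)})
    (r : nat) :
  [pchar K] =i pred0 ->
  (1 <= n)%N ->
  nondegenerate form ->
  dual_bases form b bbar ->
  is_brauer_functor form b bbar F ->
  ((r <= n)%N -> injective (F r r)) /\
  (forall le_n1_r : (n.+1 <= r)%N, forall x : brauer K r r,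
     F r r x = 0 <->
     in_generated_ideal (brauer_parameter K n)
       (extend le_n1_r (Phi_elt K n)) x).
Proof.
move=> char0 _ _ dual isF; split=> [lern x y eqF|le x].
  apply/eqP; rewrite -subr_eq0; apply/eqP.
  apply: (shallow_free char0 dual isF) => [D|]; first by rewrite diagram_shallow.
  by rewrite linearB /= eqF subrr.
rewrite (Phi_eltE n char0); set g := extend _ _.
have Fg : F r r g = 0.
  rewrite /g /extend; move: (r - n.+1)%N (subnKC le) => m e; clear le x g; case: r / e.
  rewrite /cast_brauer /= btens_suml linear_sum /=.
  apply/lfunP=> u; rewrite zero_lfunE sum_lfunE (tpowE u).
  under eq_bigr do rewrite btens_diag linear_sum.
  rewrite exchange_big big1 // => t _ /=; rewrite ptens_split.
  set u1 := ptens _; set u2 := ptens _.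
  have tensE (D : diagram n.+1 n.+1) : F _ _ (diag K (tens_diagram D (id_diagram m)))
      (entry u t *: tens u1 u2) = entry u t *: tens (F _ _ (diag K D) u1) u2.
    rewrite (functorZ F); congr (_ *: _).
    apply: etrans (functor_tens isF D (id_diagram m) u1 u2) _.
    by rewrite (functor_id isF) id_lfunE.
  under eq_bigr do rewrite tensE.
  have := sum_all_kernel char0 dual isF; rewrite linear_sum => /lfunP/(_ u1).
  rewrite zero_lfunE sum_lfunE /= => sum0.
  by rewrite -tens_sumZl -scaler_sumr sum0 scaler0 tens0l.
split; last exact: (generated_kernel isF Fg).
apply: (kernel_generated char0 dual isF) => // D S stS cS.
apply: (local_sum_ideal (generated_two_sided n g) _ stS cS).
by move=> I _; apply.
Qed.
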